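(* Let $F=F(X_1,\dots,X_n)$ be a real-valued measurable function of $n$ independent random variables. Assume that $E[F]=0$ and $E[F^2]=\sigma^2\in(0,\infty)$. Put $$Z:=\sum_{i=1}^{n}\mathfrak{D}_iF\,E[\mathfrak{D}_iF|\mathcal{F}_i],\qquad \bar Z:=\sum_{i=1}^{n}\mathfrak{D}_i\Big(\mathfrak{D}_iF\big(|E[\mathfrak{D}_iF|\mathcal{F}_i]|+E_i|E[\mathfrak{D}_iF|\mathcal{F}_i]|\big)\Big).$$ Then $$d_K(\sigma^{-1}F,N)\le \frac{\sqrt{\mathrm{Var}(Z)}}{\sigma^2}+\frac{\sqrt{\mathrm{Var}(\bar Z)}}{\sigma^2}+\frac{3\sqrt n}{\sigma^4}\mathcal{L}_4(F)+\frac{\sqrt{2\pi}}{4\sigma^3}\mathcal{L}_3(F)$$ and the right-hand side is in turn bounded by $$\frac{\sqrt{\mathcal{L}_2(Z)}}{\sigma^2}+\frac{\sqrt{\mathcal{L}_2(\bar Z)}}{\sigma^2}+\frac{3\sqrt n}{\sigma^4}\mathcal{L}_4(F)+\frac{\sqrt{2\pi}}{4\sigma^3}\mathcal{L}_3(F).$$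
   Context: $X_1,\dots,X_n$ are independent random variables (not necessarily identically distributed) on a probability space $(\Omega,\mathfrak{F},P)$ with values in a measurable space $\mathcal{X}$. For a function $F$ of $(X_1,\dots,X_n)$, $E_i$ denotes the expectation with respect to $X_i$ only; in particular $E_i[F]=E[F|\sigma(X_k,k\neq i)]$. The difference operators are $\mathfrak{D}_iF=F-E_i[F]$ for $F\in L^1(P)$. $\mathcal{F}_i=\sigma(X_k,k\le i)$. Generalized Lyapunov ratio: $\mathcal{L}_r(F):=\sum_{i=1}^n E|\mathfrak{D}_iF|^r$, $r>0$. $N$ is a standard normal random variable and $d_K(F,N)=\sup_{x\in\mathbb{R}}|P(F\le x)-P(N\le x)|$. Bounds are allowed to take the value $+\infty$ (with the variance of a non-square-integrable variable equal to $+\infty$). *)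

(* Defs.v *)
From HB Require Import structures.
From mathcomp Require Import all_boot all_order all_algebra.
From mathcomp Require Import all_classical all_reals all_analysis.

Set Implicit Arguments.
Unset Strict Implicit.
Unset Printing Implicit Defensive.

Import Order.TTheory GRing.Theory Num.Theory.
Import numFieldNormedType.Exports.

Local Open Scope classical_set_scope.
Local Open Scope ring_scope.

Section conditional_expectation.
Context d (T : measurableType d) (R : realType) (P : probability T R).
Implicit Types (G : set (set T)) (Y W : T -> R).

Definition is_condexp G Y W : Prop :=
  [/\ P.-integrable setT (EFin \o Y),
      P.-integrable setT (EFin \o W),
      forall B : set R, measurable B -> G (W @^-1` B) &
      forall A, G A ->
        (\int[P]_(w in A) (W w)%:E = \int[P]_(w in A) (Y w)%:E)%E].

(* A chosen version of E[Y | G]. It is meaningful only for Y in L^1(P) and G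
   a sub-sigma-algebra, and it is then determined up to P-null sets; when no
   version exists it defaults to 0. *)
Definition condexp G Y : T -> R := xget (cst 0) [set W | is_condexp G Y W].

End conditional_expectation.

Section independent_inputs.
Context d d' (T : measurableType d) (S : measurableType d') (R : realType)
  (P : probability T R) (n : nat).
Variable X : 'I_n -> {RV P >-> S}.

Definition mutually_independent : Prop :=
  forall (J : {set 'I_n}) (A : 'I_n -> set S),
    (forall i, measurable (A i)) ->
    P (\bigcap_(i in [set i | i \in J]) (X i @^-1` A i)) =
    (\prod_(i in J) P (X i @^-1` A i))%E.

(* sigma(X_k, k \in K) *)
Definition sigma_of (K : set 'I_n) : set (set T) :=
  <<s \bigcup_(k in K) g_sigma_algebra_preimage (X k) >>.

(* E_i Y = E[Y | sigma(X_k, k != i)] *)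
Definition Ei (i : 'I_n) (Y : T -> R) : T -> R :=
  condexp P (sigma_of [set k | k != i]) Y.

Definition Dop (i : 'I_n) (Y : T -> R) : T -> R := fun w => Y w - Ei i Y w.

(* E[Y | F_i] with F_i = sigma(X_k, k <= i). Indices start at 0, so F_i here
   is generated by i + 1 variables, X_i included. *)
Definition Efilt (i : 'I_n) (Y : T -> R) : T -> R :=
  condexp P (sigma_of [set k | (k <= i)%N]) Y.

Definition Lyapunov (r : R) (Y : T -> R) : \bar R :=
  (\sum_(i < n) 'E_P[fun w => (`|Dop i Y w| `^ r)%R])%E.

Definition Zvar (F : T -> R) : T -> R :=
  fun w => \sum_(i < n) Dop i F w * Efilt i (Dop i F) w.

Definition Zbarvar (F : T -> R) : T -> R :=
  fun w => \sum_(i < n)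
    Dop i (fun v => Dop i F v *
      (`|Efilt i (Dop i F) v| + Ei i (fun u => `|Efilt i (Dop i F) u|) v)) w.

End independent_inputs.

Section kolmogorov_distance.
Context d d' (T : measurableType d) (T' : measurableType d') (R : realType)
  (P : probability T R) (Q : probability T' R).
Local Open Scope ereal_scope.

Definition standard_normal (N : {RV Q >-> R}) : Prop :=
  forall A : set R, measurable A -> distribution Q N A = normal_prob 0 1 A.

(* The two variables may live on different probability spaces. *)
Definition d_K (F : T -> R) (N : T' -> R) : \bar R :=
  ereal_sup [set `|P [set w | (F w <= x)%R] - Q [set w | (N w <= x)%R]|
            | x in [set: R]].

End kolmogorov_distance.

(* Main.v *)
Require Import Defs.
From HB Require Import structures.
From mathcomp Require Import all_boot all_order all_algebra.
From mathcomp Require Import all_classical all_reals all_analysis.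
From mathcomp Require Import measurable_realfun ring lra.

Set Implicit Arguments.
Unset Strict Implicit.
Unset Printing Implicit Defensive.

Import Order.TTheory GRing.Theory Num.Theory.
Import numFieldNormedType.Exports.

Local Open Scope classical_set_scope.
Local Open Scope ring_scope.

(** Write [A_i = E[D_i F | F_i]].  Since [F] is the sum of the martingale
    differences [A_i] and [E_i A_i = 0], one has the covariance identity
    [E[F G] = sum_i E[A_i D_i G]]; with [G = F] it gives the Efron-Stein
    inequality and [E Z = sigma^2].  With [G = g(F)], [g] the solution of the
    Stein equation for the half-line [(-oo, x]], it leaves the remainder
    [g'(u)(u - v) - (g(u) - g(v))] to be estimated, where [u] is the value of [F]
    and [v] its value after resampling [X_i].  Now
    [g'(w) = w g(w) - 1{w > x} + const] is a difference of two nondecreasing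
    functions of oscillation at most 1, so the remainder is at most
    [(u - v)(k(u) - k(v))] with [k(w) = w g(w) + 1{w > x}].  Weighting this by
    [|A_i|] and moving [E_i] across by self-adjointness produces exactly
    [E[k(F) Zbar]], whence the stronger estimate
    [d_K <= (E|sigma^2 - Z| + E|Zbar|) / sigma^2], in which the terms with
    [L_3] and [L_4] are absent.  Conditional expectations are computed on the
    space of n-tuples carrying the law of [(X_1, ..., X_n)], where by
    independence they integrate out the resampled coordinates. *)

(** * Sign of a function from the sign of its derivative *)

Section derivative_tests.
Context {R : realType}.
Implicit Types (f df : R -> R) (a b : R).

Lemma is_derive_within_continuous f df a b :
  (forall w, a <= w -> is_derive w 1 f (df w)) ->
  {within `[a, b], continuous f}.
Proof.
move=> fdf; apply: derivable_within_continuous => w.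
by rewrite in_itv/= => /andP[aw _]; apply: ex_derive; exact: fdf.
Qed.

Lemma MVT_is_derive f df a b : a <= b ->
  (forall w, a <= w -> is_derive w 1 f (df w)) ->
  exists2 c, a <= c <= b & f b - f a = df c * (b - a).
Proof.
move=> ab fdf.
have [|c cab ->] := @MVT_segment _ f df a b ab _ (is_derive_within_continuous fdf).
  by move=> w; rewrite in_itv/= => /andP[/ltW aw _]; exact: fdf.
by exists c => //; move: cab; rewrite in_itv.
Qed.

(** If [f a] were negative, [f] would stay below [f a] on the whole half-line, against the lower
    bound 0 in the limit. This turns the sign of a derivative into a Gaussian tail inequality. *)
Lemma nonincreasing_vanishing_ge0 f df a :
  (forall w, a <= w -> is_derive w 1 f (df w)) ->
  (forall w, a <= w -> df w <= 0) ->
  (forall e, 0 < e -> exists W, forall w, W <= w -> - e <= f w) ->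
  0 <= f a.
Proof.
move=> fdf df0 fe; rewrite leNgt; apply/negP => fa0.
have [|W fW] := fe (- f a / 2); first by lra.
pose b := Num.max a W.
have ab : a <= b by rewrite /b le_max lexx.
have Wb : W <= b by rewrite /b le_max lexx orbT.
have [c /andP[ac _] Df] := MVT_is_derive ab fdf.
have := fW b Wb; have : df c * (b - a) <= 0.
  by rewrite mulr_le0_ge0 ?df0// subr_ge0.
by rewrite -Df; lra.
Qed.

End derivative_tests.

(** * The Stein equation for half-lines *)

Section mills_ratio.
Context {R : realType}.
Local Notation phi := (@normal_pdf R 0 1).

Lemma normal_pdf01E : phi = fun w => @normal_peak R 1 * expR (- (w ^+ 2 / 2)).
Proof.
apply/funext => w; rewrite normal_pdfE ?oner_eq0// /normal_fun subr0.
by rewrite expr1n mulNr.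
Qed.

Lemma normal_pdf01_gt0 (w : R) : 0 < phi w.
Proof. by rewrite normal_pdf01E mulr_gt0 ?expR_gt0 ?normal_peak_gt0 ?oner_eq0. Qed.

Lemma normal_pdf01N (w : R) : phi (- w) = phi w.
Proof. by rewrite normal_pdf01E sqrrN. Qed.

Lemma is_derive_normal_pdf01 (w : R) : is_derive w 1 phi (- (w * phi w)).
Proof.
rewrite normal_pdf01E.
have -> : (fun w : R => normal_peak 1 * expR (- (w ^+ 2 / 2))) =
  normal_peak 1 \*: (expR \o (- 2^-1 \*: (id ^+ 2 : R -> R))).
  apply/funext => v /=; congr (_ * expR _).
  by rewrite mulrC -mulNr.
apply: is_derive_eq => /=; rewrite /GRing.scale/=.
rewrite (_ : - 2^-1 * (id ^+ 2) w = - (w ^+ 2 / 2)); last by rewrite mulNr mulrC.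
by field.
Qed.

(* Applied to both tails, [q w = 1 - normal_cdf w] and [q w = normal_cdf (- w)]. *)
Variable q : R -> R.
Hypothesis dq : forall w : R, is_derive w 1 q (- phi w).
Hypothesis q0 : forall e, 0 < e -> exists W : R, forall w, W <= w -> `|q w| <= e.

(** Upper Mills bound: [phi v / v - q v] has derivative [- phi v / v ^+ 2] and is asymptotically
    nonnegative. *)
Lemma tail_mul_le_pdf (w : R) : 0 < w -> w * q w <= phi w.
Proof.
move=> w0; suff : 0 <= phi w / w - q w.
  by rewrite subr_ge0 ler_pdivlMr// mulrC.
apply: (@nonincreasing_vanishing_ge0 _ (fun v => phi v / v - q v)
  (fun v => - (phi v / v ^+ 2))) => [v wv|v wv|e e0].
- have v0 : id v != 0 by rewrite gt_eqF// (lt_le_trans w0).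
  have := is_derive_normal_pdf01 v => dphi.
  have d := is_deriveB (is_deriveM dphi (is_deriveV v0 (is_derive_id v 1))) (dq v).
  apply: (is_derive_eq d); rewrite /GRing.scale/=; field.
  by rewrite v0.
- by rewrite oppr_le0 divr_ge0 ?sqr_ge0// ltW// normal_pdf01_gt0.
- have [W qW] := q0 e0; exists (Num.max W 0) => v; rewrite ge_max => /andP[Wv v0].
  rewrite (le_trans (y := - q v))//.
    by rewrite lerN2 (le_trans (ler_norm _))// qW.
  by rewrite lerDr divr_ge0// ltW// normal_pdf01_gt0.
Qed.

(** Lower Mills bound, by the same test for [q v - v * phi v / (1 + v ^+ 2)], whose derivative is
    [- 2 * phi v / (1 + v ^+ 2) ^+ 2]. The denominator never vanishes, so [w] may have either
    sign. *)
Lemma pdf_mul_le_tail (w : R) : w * phi w <= (1 + w ^+ 2) * q w.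
Proof.
have sq1 (v : R) : 0 < 1 + v ^+ 2 by rewrite ltr_wpDr ?sqr_ge0.
suff : 0 <= q w - w * phi w / (1 + w ^+ 2).
  by rewrite subr_ge0 ler_pdivrMr// [X in _ <= X]mulrC.
apply: (@nonincreasing_vanishing_ge0 _ (fun v => q v - v * phi v / (1 + v ^+ 2))
  (fun v => - (2 * phi v / (1 + v ^+ 2) ^+ 2))) => [v wv|v wv|e e0].
- have v0 : (cst 1 + id ^+ 2 : R -> R) v != 0 by rewrite gt_eqF// sq1.
  have := is_derive_normal_pdf01 v => dphi.
  have dsq : is_derive v 1 (cst 1 + id ^+ 2 : R -> R) (2 * v).
    by apply: is_derive_eq; rewrite /GRing.scale/=; ring.
  have d := is_deriveB (dq v) (is_deriveM (is_deriveM (is_derive_id v 1) dphi)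
    (is_deriveV v0 dsq)).
  apply: (is_derive_eq d); rewrite /GRing.scale/=.
  rewrite (_ : (cst 1 + id ^+ 2 : R -> R) v = 1 + v ^+ 2)//.
  rewrite (_ : (id * phi) v = v * phi v)//.
  by field; rewrite gt_eqF// sq1.
- by rewrite oppr_le0 divr_ge0 ?sqr_ge0// mulr_ge0// ltW// normal_pdf01_gt0.
- have e20 : 0 < e / 2 by lra.
  have [W qW] := q0 e20.
  pose k : R := normal_peak 1.
  have k0 : 0 < k by rewrite /k normal_peak_gt0 ?oner_eq0.
  (* Half of [e] goes to [q v]. Since [phi <= k], the other term is at most [k / v], which is at
     most [e / 2] once [v >= 2 * k / e]. *)
  exists (Num.max W (Num.max 0 (k * 2 / e))) => v.
  rewrite !ge_max => /and3P[Wv v0 kv].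
  have h1 : `|q v| <= e / 2 by exact: qW.
  have h2 : v * phi v / (1 + v ^+ 2) <= e / 2.
    rewrite ler_pdivrMr// (@le_trans _ _ (v * k))//.
      by rewrite ler_wpM2l// normal_pdf_ub ?oner_eq0.
    move: kv; rewrite ler_pdivrMr// => kv.
    have : v * (k * 2) <= v * (v * e) by rewrite ler_wpM2l.
    by rewrite expr2; nra.
  by have := ler_norm (- q v); rewrite normrN; lra.
Qed.

Definition mills (w : R) := q w / phi w.

(** This is the Stein equation with constant right-hand side; both branches of [stein_sol] are
    multiples of such a ratio. *)
Lemma is_derive_mills (w : R) : is_derive w 1 mills (w * mills w - 1).
Proof.
have pw0 : phi w != 0 by rewrite gt_eqF// normal_pdf01_gt0.
have := is_derive_normal_pdf01 w => dphi.
have d := is_deriveM (dq w) (is_deriveV pw0 dphi).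
by apply: (is_derive_eq d); rewrite /GRing.scale/= /mills; field.
Qed.

(** The derivative of [w * mills w] is [((1 + w ^+ 2) * q w - w * phi w) / phi w], which the lower
    Mills bound makes nonnegative. *)
Lemma nondecreasing_mul_mills (v w : R) : v <= w -> v * mills v <= w * mills w.
Proof.
move=> vw; rewrite -subr_ge0.
have [|c _ ->] := @MVT_is_derive _ (fun w => w * mills w)
   (fun w => ((1 + w ^+ 2) * q w - w * phi w) / phi w) _ _ vw.
  move=> u _; have := is_derive_mills u => du.
  have d := is_deriveM (is_derive_id u 1) du.
  apply: (is_derive_eq d); rewrite /GRing.scale/= /mills; field.
  by rewrite gt_eqF// normal_pdf01_gt0.
by rewrite mulr_ge0 ?subr_ge0// divr_ge0 ?subr_ge0 ?pdf_mul_le_tail// ltW// normal_pdf01_gt0.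
Qed.

Lemma mul_mills_le1 (w : R) : w * mills w <= 1.
Proof.
have [w0|w0] := ltP 0 w.
  by rewrite /mills mulrA ler_pdivrMr ?normal_pdf01_gt0// mul1r tail_mul_le_pdf.
rewrite (le_trans (nondecreasing_mul_mills w0))// mul0r ler01//.
Qed.

End mills_ratio.

(** * The standard normal distribution function and its two tails *)

Section normal_tails.
Context {R : realType} disp (T : measurableType disp) (Q : probability T R).
Variable N : {RV Q >-> R}.
Hypothesis stdN : standard_normal N.
Local Notation phi := (@normal_pdf R 0 1).

(** Defined from [normal_prob]; its limits at infinity come from those of [cdf N] through
    [normal_cdfE]. *)
Definition normal_cdf (x : R) : R := fine (normal_prob 0 1 `]-oo, x]).

Lemma normal_cdf_ge0 x : 0 <= normal_cdf x.
Proof. by rewrite fine_ge0. Qed.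

Lemma normal_cdf_le1 x : normal_cdf x <= 1.
Proof.
by rewrite -lee_fin fineK ?fin_num_measure// probability_le1.
Qed.

Lemma normal_cdfE : normal_cdf = fine \o cdf N.
Proof. by apply/funext => x /=; rewrite /cdf stdN. Qed.

Lemma is_derive_normal_cdf (x : R) : is_derive x 1 normal_cdf (phi x).
Proof.
have xu : x < x + 1 by rewrite ltrDl.
have iphi : lebesgue_measure.-integrable [set` Interval -oo%O (BRight (x + 1))]
    (EFin \o phi).
  by apply: integrableS (integrable_normal_pdf 0 1).
have [|dF DF] := continuous_FTC1 xu iphi (ltNyr _).
  exact/continuous_normal_pdf/oner_neq0.
by split; rewrite -?derive1E.
Qed.

Lemma normal_cdf_tail (e : R) : 0 < e ->
  exists W, forall w, W <= w -> `|1 - normal_cdf w| <= e.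
Proof.
move=> e0; have /fine_cvg/cvgrPdist_le/(_ e e0) := cvg_cdfy1 N.
rewrite -normal_cdfE => -[M [_ MW]]; exists (M + 1) => w Mw.
by apply: MW; rewrite (lt_le_trans _ Mw)// ltrDl.
Qed.

Lemma normal_cdf_tailN (e : R) : 0 < e ->
  exists W, forall w, W <= w -> `|normal_cdf (- w)| <= e.
Proof.
move=> e0; have /fine_cvg/cvgrPdist_le/(_ e e0) := cvg_cdfNy0 N.
rewrite -normal_cdfE => -[M [_ MW]]; exists (1 - M) => w Mw.
by rewrite -normrN -sub0r; apply: MW; lra.
Qed.

Lemma is_derive_normal_ccdf (x : R) : is_derive x 1 (fun w => 1 - normal_cdf w) (- phi x).
Proof.
have d := is_deriveB (is_derive_cst (1 : R) x 1) (is_derive_normal_cdf x).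
by apply: (is_derive_eq d); rewrite sub0r.
Qed.

Lemma is_derive_normal_cdfN (x : R) :
  is_derive x 1 (fun w => normal_cdf (- w)) (- phi x).
Proof.
have d := is_derive1_comp (is_derive_normal_cdf (- x)) (is_deriveNid x 1).
by apply: (is_derive_eq d); rewrite normal_pdf01N mulrN1.
Qed.

End normal_tails.

(** * Monotonicity, bounds and first-order remainder of the Stein solution *)

Section stein_solution.
Context {R : realType} disp (T : measurableType disp) (Q : probability T R).
Variable N : {RV Q >-> R}.
Hypothesis stdN : standard_normal N.
Local Notation phi := (@normal_pdf R 0 1).
Variable x : R.
Let c := normal_cdf x.

Let gr (w : R) := c * mills (fun v => 1 - normal_cdf v) w.
Let gl (w : R) := (1 - c) * mills (fun v => normal_cdf (- v)) (- w).

(** The solution of [g' w = w * g w + 1{w <= x} - c]: with [Phi] the normal distribution function,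
    it is [c * (1 - Phi w) / phi w] on the right of [x] and [(1 - c) * Phi w / phi w] on the left,
    the latter written as a Mills ratio at [- w]. *)
Definition stein_sol (w : R) := if w <= x then gl w else gr w.
Local Notation g := stein_sol.

Let h (w : R) : R := if w <= x then 0 else 1.

Let a w := w * g w.

Let grl : gr x = gl x.
Proof.
by rewrite /gr /gl /mills opprK normal_pdf01N -/c mulrA [c * _]mulrC mulrA.
Qed.

Let is_derive_gr (w : R) : is_derive w 1 gr (w * gr w - c).
Proof.
have d1 := is_derive_mills (is_derive_normal_ccdf) w.
have d := is_deriveZ c d1.
apply: (is_derive_eq d); rewrite /GRing.scale/= /gr; ring.
Qed.

Let is_derive_gl (w : R) : is_derive w 1 gl (w * gl w + (1 - c)).
Proof.
have d1 := is_derive_mills (is_derive_normal_cdfN) (- w).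
have d := is_deriveZ (1 - c) (is_derive1_comp d1 (is_deriveNid w 1)).
apply: (is_derive_eq d); rewrite /GRing.scale/= /gl; ring.
Qed.

Let c01 : 0 <= c <= 1. Proof. by rewrite normal_cdf_ge0 normal_cdf_le1. Qed.

Let c0 : 0 <= c. Proof. by case/andP: c01. Qed.
Let c1 : 0 <= 1 - c. Proof. by rewrite subr_ge0; case/andP: c01. Qed.

Let gr_nd v w : v <= w -> v * gr v <= w * gr w.
Proof.
move=> vw; rewrite /gr !(mulrCA _ c) ler_wpM2l//.
exact: (nondecreasing_mul_mills is_derive_normal_ccdf (normal_cdf_tail stdN)).
Qed.

Let gl_nd v w : v <= w -> v * gl v <= w * gl w.
Proof.
move=> vw; rewrite /gl !(mulrCA _ (1 - c)) ler_wpM2l//.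
rewrite -lerN2 -!mulNr.
apply: (nondecreasing_mul_mills is_derive_normal_cdfN (normal_cdf_tailN stdN)).
by rewrite lerN2.
Qed.

Let a_nd v w : v <= w -> a v <= a w.
Proof.
rewrite /a /g; case: (leP v x) => vx; case: (leP w x) => wx vw.
- exact: gl_nd.
- by rewrite (le_trans (gl_nd vx))// -grl gr_nd// ltW.
- by move: vx; rewrite ltNge (le_trans vw).
- exact: gr_nd.
Qed.

(** On the right of [x] this is [mul_mills_le1]; on the left, monotonicity of [a] compares with a
    point beyond [x]. Together with [a_lb] it confines [a] to an interval of length 1. *)
Let a_ub w : a w <= c.
Proof.
have aub v : x < v -> a v <= c.
  move=> xv; rewrite /a /g [v <= x]leNgt xv/= /gr mulrCA ler_piMr//.
  exact: (mul_mills_le1 is_derive_normal_ccdf (normal_cdf_tail stdN)).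
have [wx|] := leP w x; last exact: aub.
have x1 : x < x + 1 by rewrite ltrDl.
by rewrite (le_trans (a_nd _) (aub _ x1))// (le_trans wx)// ltW.
Qed.

Let a_lb w : c - 1 <= a w.
Proof.
have alb v : v <= x -> c - 1 <= a v.
  move=> xv; rewrite /a /g xv/= /gl mulrCA -opprB -[X in _ <= X]opprK lerN2 -mulrN -mulNr ler_piMr//.
  exact: (mul_mills_le1 is_derive_normal_cdfN (normal_cdf_tailN stdN)).
have [wx|xw] := leP w x; first exact: alb.
by rewrite (le_trans (alb x _) (a_nd _))// ltW.
Qed.

Let h01 w : 0 <= h w <= 1. Proof. by rewrite /h; case: ifP; rewrite ?lexx ?ler01. Qed.

(** Formally [g' = a + 1 - c - h] with [a] and [h] nondecreasing, so [g'] on [[v, u]] lies between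
    the values obtained by taking [a] and [h] at opposite ends. The mean value theorem applies on
    each side of the kink [x]; when [x] separates [v] and [u], the two pieces are added. *)
Lemma stein_sol_increment v u : v <= u ->
  (u - v) * (a v + 1 - c - h u) <= g u - g v <= (u - v) * (a u + 1 - c - h v).
Proof.
move=> vu; have uv0 : 0 <= u - v by rewrite subr_ge0.
have incl v' u' : v' <= u' -> u' <= x ->
  (u' - v') * (a v' + 1 - c) <= gl u' - gl v' <= (u' - v') * (a u' + 1 - c).
  move=> vu' ux; have [e /andP[ve eu] ->] := MVT_is_derive vu' (fun w _ => is_derive_gl w).
  have ag t : t <= x -> a t = t * gl t by rewrite /a /g => ->.
  rewrite !ag// ?(le_trans vu')// [X in X <= _ <= _]mulrC [X in _ <= _ <= X]mulrC.
  by rewrite !ler_wpM2r ?subr_ge0// -!addrA lerD2r gl_nd.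
have incr v' u' : v' <= u' -> x <= v' ->
  (u' - v') * (a v' - c) <= gr u' - gr v' <= (u' - v') * (a u' - c).
  move=> vu' xv; have [e /andP[ve eu] ->] := MVT_is_derive vu' (fun w _ => is_derive_gr w).
  have ag t : x <= t -> a t = t * gr t.
    by rewrite /a /g le_eqVlt => /predU1P[<-|]; rewrite ?lexx ?grl// leNgt => ->.
  rewrite !ag// ?(le_trans xv)// [X in X <= _ <= _]mulrC [X in _ <= _ <= X]mulrC.
  by rewrite !ler_wpM2r ?subr_ge0// lerD2r gr_nd.
have gle t : t <= x -> g t = gl t by rewrite /g => ->.
have ggt t : x < t -> g t = gr t by rewrite /g leNgt => ->.
have hle t : t <= x -> h t = 0 by rewrite /h => ->.
have hgt t : x < t -> h t = 1 by rewrite /h leNgt => ->.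
have [ux|xu] := leP u x; have [vx|xv] := leP v x.
- by rewrite !hle// !gle// !subr0 incl.
- by move: xv; rewrite ltNge (le_trans vu).
- rewrite (hgt u)// (hle v)// (ggt u)// (gle v)//.
  have /andP[l1 l2] := incl v x vx (lexx _).
  have /andP[r1 r2] := incr x u (ltW xu) (lexx _).
  have avx := a_nd vx; have axu := a_nd (ltW xu).
  have xv0 : 0 <= x - v by rewrite subr_ge0.
  have ux0 : 0 <= u - x by rewrite subr_ge0 ltW.
  rewrite grl in r1 r2.
  have m1 : 0 <= (x - v) * (a u - a x) by rewrite mulr_ge0// subr_ge0.
  have m2 : 0 <= (u - x) * (a x - a v) by rewrite mulr_ge0// subr_ge0.
  by apply/andP; split; lra.
- rewrite !hgt// !ggt// -[_ + 1 - c]addrA [1 - c]addrC addrA addrK.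
  by rewrite -[_ + 1 - c]addrA [1 - c]addrC addrA addrK incr// ltW.
Qed.

(** The bounds [c - 1 <= a <= c] and [0 <= h <= 1] put both slopes of [stein_sol_increment] within
    [-1, 1]. *)
Lemma stein_sol_lipschitz u v : `|g u - g v| <= `|u - v|.
Proof.
wlog vu : u v / v <= u => [H|].
  by have [/H//|/ltW/H] := leP v u; rewrite distrC (distrC v).
have /andP[l1 l2] := stein_sol_increment vu.
have uv0 : 0 <= u - v by rewrite subr_ge0.
have hu := h01 u; have hv := h01 v; have au := a_ub u; have av := a_lb v.
have m1 : 0 <= (u - v) * (a v + 1 - c - h u + 1) by rewrite mulr_ge0//; lra.
have m2 : 0 <= (u - v) * (1 - (a u + 1 - c - h v)) by rewrite mulr_ge0//; lra.
by rewrite (ger0_norm uv0) ler_norml; apply/andP; split; lra.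
Qed.

(* The derivative of [stein_sol x], extended to the kink [w = x] by the Stein
   equation. *)
Definition stein_sol' (w : R) : R := w * g w + (w <= x)%R%:R - c.

(** Up to a constant, [stein_sol'] is the difference of these two nondecreasing terms; their sum
    dominates its increments. *)
Definition stein_osc (w : R) : R := w * g w + (x < w)%R%:R.

Let sol'E w : stein_sol' w = a w + 1 - c - h w.
Proof. by rewrite /stein_sol' /a /h; case: leP => _ /=; ring. Qed.

Let oscE w : stein_osc w = a w + h w.
Proof. by rewrite /stein_osc /a /h; case: leP => _ /=; ring. Qed.

Lemma stein_sol'_le1 w : `|stein_sol' w| <= 1.
Proof.
rewrite sol'E; have := a_ub w; have := a_lb w; have := h01 w.
by move=> *; rewrite ler_norml; apply/andP; split; lra.
Qed.

(** Only increments of [stein_osc] enter the remainder, so it may be centred freely; centring at [c]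
    gives the bound 1. *)
Lemma stein_osc_le1 w : `|stein_osc w - c| <= 1.
Proof.
rewrite oscE; have := a_ub w; have := a_lb w; have := h01 w.
by move=> *; rewrite ler_norml; apply/andP; split; lra.
Qed.

(** By monotonicity of [a] and [h], the linear term lies in the same interval as the increment in
    [stein_sol_increment], and the right-hand side is the length of that interval. *)
Lemma stein_sol_remainder u v :
  `|stein_sol' u * (u - v) - (g u - g v)| <= (u - v) * (stein_osc u - stein_osc v).
Proof.
rewrite sol'E !oscE.
have h_nd s t : s <= t -> h s <= h t.
  rewrite /h => st; case: (leP s x) => sx; case: (leP t x) => tx //.
  by move: sx; rewrite ltNge (le_trans st).
have [vu|/ltW uv] := leP v u.
  have /andP[l1 l2] := stein_sol_increment vu.
  have := a_nd vu; have := h_nd _ _ vu.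
  by move=> *; rewrite ler_norml; apply/andP; split; nra.
have /andP[l1 l2] := stein_sol_increment uv.
have := a_nd uv; have := h_nd _ _ uv.
by move=> *; rewrite ler_norml; apply/andP; split; nra.
Qed.

Lemma measurable_stein_sol : measurable_fun setT g.
Proof.
apply: continuous_measurable_fun => w.
apply/cvgrPdist_lt => e e0; near=> v.
by rewrite (le_lt_trans (stein_sol_lipschitz _ _))//; near: v; exact: cvgr_dist_lt.
Unshelve. all: by end_near. Qed.

Lemma measurable_stein_sol' : measurable_fun setT stein_sol'.
Proof.
apply: measurable_funB => //; apply: measurable_funD.
  by apply: measurable_funM => //; exact: measurable_stein_sol.
rewrite (_ : (fun w => _) = \1_(`]-oo, x]%classic : set R)).
  by apply: measurable_indic.
by apply/funext => w; rewrite indicE mem_setE in_itv.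
Qed.

Lemma measurable_stein_osc : measurable_fun setT stein_osc.
Proof.
apply: measurable_funD.
  by apply: measurable_funM => //; exact: measurable_stein_sol.
rewrite (_ : (fun w => _) = \1_(`]x, +oo[%classic : set R)).
  by apply: measurable_indic.
by apply/funext => w; rewrite indicE mem_setE in_itv/= andbT.
Qed.

End stein_solution.

(** * Integrability and measure-preserving maps *)

Section measure_preserving.
Context {R : realType}.

Definition preserves d1 d2 (T1 : measurableType d1) (T2 : measurableType d2)
    (m1 : set T1 -> \bar R) (m2 : set T2 -> \bar R) (h : T1 -> T2) :=
  measurable_fun setT h /\ forall A, measurable A -> m1 (h @^-1` A) = m2 A.

Context d1 d2 (T1 : measurableType d1) (T2 : measurableType d2).
Variables (m1 : {measure set T1 -> \bar R}) (m2 : {measure set T2 -> \bar R}).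
Variable h : T1 -> T2.
Hypothesis hP : preserves m1 m2 h.

Let mh : measurable_fun setT h. Proof. by case: hP. Qed.

Lemma preserves_ge0_integral (f : T2 -> \bar R) : measurable_fun setT f ->
  (forall x, 0 <= f x)%E -> (\int[m1]_x f (h x) = \int[m2]_x f x)%E.
Proof.
move=> mf f0; transitivity (\int[pushforward m1 h]_x f x)%E.
  by rewrite (ge0_integral_pushforward mh)// preimage_setT.
by apply: eq_measure_integral => //= A mA _; case: hP => _ /(_ A mA).
Qed.

Lemma preserves_integrable (f : T2 -> \bar R) : measurable_fun setT f ->
  m1.-integrable setT (f \o h) <-> m2.-integrable setT f.
Proof.
move=> mf; have E : (\int[m1]_x `|f (h x)| = \int[m2]_x `|f x|)%E.
  by apply: (@preserves_ge0_integral (fun x => `|f x|%E)) => //; exact: measurableT_comp.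
split=> /integrableP[mf' fy]; apply/integrableP; split => //.
- by rewrite -E.
- exact: measurableT_comp.
- by rewrite [ltLHS]E.
Qed.

Lemma preserves_integral (f : T2 -> \bar R) : m2.-integrable setT f ->
  (\int[m1]_x f (h x) = \int[m2]_x f x)%E.
Proof.
move=> fi; have mf := measurable_int _ fi.
transitivity (\int[pushforward m1 h]_x f x)%E.
  by rewrite (integral_pushforward mh)//; exact/preserves_integrable.
by apply: eq_measure_integral => //= A mA _; case: hP => _ /(_ A mA).
Qed.

End measure_preserving.

(** * Integrable and square-integrable real functions *)

Section real_integrals.
Context {R : realType} d (T : measurableType d) (P : probability T R).
Implicit Types y z : T -> R.

Definition L1 y := P.-integrable setT (EFin \o y).
(** Measurability is asked separately because that of the square does not imply it. *)
Definition L2 y := measurable_fun setT y /\ L1 (fun x => y x ^+ 2).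
Local Notation E y := (\int[P]_x y x).

Lemma L1_measurable y : L1 y -> measurable_fun setT y.
Proof. by move=> /(measurable_int P)/measurable_EFinP. Qed.

Lemma L1_le y z : measurable_fun setT y -> (forall x, `|y x| <= `|z x|) ->
  L1 z -> L1 y.
Proof.
move=> my yz; apply: le_integrable => //; first exact/measurable_EFinP.
by move=> x _; rewrite lee_fin.
Qed.

Lemma L1_cst (r : R) : L1 (cst r).
Proof. by apply: finite_measure_integrable_cst. Qed.

Lemma L1D y z : L1 y -> L1 z -> L1 (fun x => y x + z x).
Proof. by move=> iy iz; apply: (integrableD _ iy iz). Qed.

Lemma L1B y z : L1 y -> L1 z -> L1 (fun x => y x - z x).
Proof. by move=> iy iz; apply: (integrableB _ iy iz). Qed.

Lemma L1Z r y : L1 y -> L1 (fun x => r * y x).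
Proof. by move=> iy; apply: (integrableZl _ r iy). Qed.

Lemma L1_sum n (y : 'I_n -> T -> R) : (forall i, L1 (y i)) ->
  L1 (fun x => \sum_(i < n) y i x).
Proof.
elim: n y => [|n IH] y iy.
  rewrite (_ : (fun _ => _) = cst 0); first exact: L1_cst.
  by apply/funext => x; rewrite big_ord0.
rewrite (_ : (fun _ => _) = fun x => y ord0 x + \sum_(i < n) y (lift ord0 i) x).
  by apply: L1D => //; exact: IH.
by apply/funext => x; rewrite big_ord_recl.
Qed.

Lemma L1_norm y : L1 y -> L1 (fun x => `|y x|).
Proof.
move=> iy; apply: (L1_le _ _ iy) => [|x]; last by rewrite normr_id.
by apply: measurableT_comp => //; exact: L1_measurable.
Qed.

Lemma L1_bounded y (M : R) : measurable_fun setT y -> (forall x, `|y x| <= M) -> L1 y.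
Proof.
move=> my yM; apply: (L1_le my _ (L1_cst M)) => x /=.
by rewrite (le_trans (yM x))// ler_norm.
Qed.

Lemma L1M_bounded y z (M : R) : L1 y -> measurable_fun setT z ->
  (forall x, `|z x| <= M) -> L1 (fun x => y x * z x).
Proof.
move=> iy mz zM; apply: (L1_le _ _ (L1Z M iy)) => [|x].
  by apply: measurable_funM => //; exact: L1_measurable.
rewrite !normrM mulrC ler_wpM2r// (le_trans (zM x))// ler_norm//.
Qed.

Lemma L2_measurable y : L2 y -> measurable_fun setT y. Proof. by case. Qed.

Lemma L2M y z : L2 y -> L2 z -> L1 (fun x => y x * z x).
Proof.
move=> [my iy] [mz iz]; apply: (L1_le _ _ (L1D iy iz)) => [|x].
  exact: measurable_funM.
rewrite normrM [X in _ <= X]ger0_norm ?addr_ge0 ?sqr_ge0//.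
rewrite -(real_normK (num_real (y x))) -(real_normK (num_real (z x))).
by have := sqr_ge0 (`|y x| - `|z x|); have := sqr_ge0 (`|y x| + `|z x|); rewrite sqrrB sqrrD; lra.
Qed.

Lemma L2_cst r : L2 (cst r).
Proof. by split => //; exact: (L1_cst (r ^+ 2)). Qed.

Lemma L2_L1 y : L2 y -> L1 y.
Proof.
move=> /L2M - /(_ _ (L2_cst 1)).
by under eq_fun do rewrite /cst mulr1.
Qed.

Lemma L2_le y z : measurable_fun setT y -> (forall x, `|y x| <= `|z x|) ->
  L2 z -> L2 y.
Proof.
move=> my yz [_ iz]; split => //; apply: (L1_le _ _ iz).
  exact: measurable_funX.
by move=> x; rewrite !normrX lerXn2r ?nnegrE.
Qed.

Lemma L2Z r y : L2 y -> L2 (fun x => r * y x).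
Proof.
move=> [my iy]; split; first exact: measurable_funM.
by under eq_fun do rewrite exprMn; exact: L1Z.
Qed.

Lemma L2D y z : L2 y -> L2 z -> L2 (fun x => y x + z x).
Proof.
move=> y2 z2; split; first by apply: measurable_funD; exact: L2_measurable.
have i := L1D (L1D (proj2 y2) (proj2 z2)) (L1Z 2 (L2M y2 z2)).
apply: (L1_le _ _ i) => [|x].
  by apply: measurable_funX; apply: measurable_funD; exact: L2_measurable.
by rewrite (_ : _ ^+ 2 + _ + _ = (y x + z x) ^+ 2)//; ring.
Qed.

Lemma L2B y z : L2 y -> L2 z -> L2 (fun x => y x - z x).
Proof.
move=> y2 z2; have := L2D y2 (L2Z (-1) z2).
by under eq_fun do rewrite mulN1r.
Qed.

Lemma L2_norm y : L2 y -> L2 (fun x => `|y x|).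
Proof.
move=> y2; apply: (L2_le _ _ y2) => [|x]; last by rewrite normr_id.
by apply: measurableT_comp => //; exact: L2_measurable.
Qed.

Lemma L2_sum n (y : 'I_n -> T -> R) : (forall i, L2 (y i)) ->
  L2 (fun x => \sum_(i < n) y i x).
Proof.
elim: n y => [|n IH] y iy.
  rewrite (_ : (fun _ => _) = cst 0); first exact: L2_cst.
  by apply/funext => x; rewrite big_ord0.
rewrite (_ : (fun _ => _) = fun x => y ord0 x + \sum_(i < n) y (lift ord0 i) x).
  by apply: L2D => //; exact: IH.
by apply/funext => x; rewrite big_ord_recl.
Qed.

Lemma L2M_bounded y z (M : R) : L2 y -> measurable_fun setT z ->
  (forall x, `|z x| <= M) -> L2 (fun x => y x * z x).
Proof.
move=> y2 mz zM; apply: (L2_le _ _ (L2Z M y2)) => [|x].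
  by apply: measurable_funM => //; exact: L2_measurable.
rewrite !normrM mulrC ler_wpM2r// (le_trans (zM x))// ler_norm//.
Qed.

Lemma ae_Rintegral y z : measurable_fun setT y -> measurable_fun setT z ->
  {ae P, forall x, y x = z x} -> E y = E z.
Proof.
move=> my mz yz; congr fine; apply: ae_eq_integral => //; try exact/measurable_EFinP.
by apply: filterS yz => x -> _.
Qed.

Lemma ae_L1 y z : measurable_fun setT z ->
  {ae P, forall x, y x = z x} -> L1 y -> L1 z.
Proof.
move=> mz yz /integrableP[my iy]; apply/integrableP; split; first exact/measurable_EFinP.
rewrite -(@ae_eq_integral _ _ _ _ _ _ (fun x => `|(EFin \o y) x|%E))//.
- exact: measurableT_comp.
- by apply: measurableT_comp => //; exact/measurable_EFinP.
- by apply: filterS yz => x /= -> _.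
Qed.

Lemma ae_L2 y z : measurable_fun setT z ->
  {ae P, forall x, y x = z x} -> L2 y -> L2 z.
Proof.
move=> mz yz [my iy]; split => //; apply: ae_L1 iy; first exact: measurable_funX.
by apply: filterS yz => x ->.
Qed.

Lemma ae_le_Rintegral y z : L1 y -> L1 z ->
  {ae P, forall x, y x <= z x} -> E y <= E z.
Proof.
move=> iy iz yz; rewrite -subr_ge0 -RintegralB//.
rewrite (@ae_Rintegral _ (fun x => `|z x - y x|)).
- by apply: Rintegral_ge0.
- exact/L1_measurable/L1B.
- exact/L1_measurable/L1_norm/L1B.
- by apply: filterS yz => x yz; rewrite ger0_norm// subr_ge0.
Qed.

Lemma RintegralT_cst (r : R) : \int[P]_x r = r.
Proof. by rewrite Rintegral_cst// [X in fine X](_ : _ = 1%E) ?mulr1//; exact: probability_setT. Qed.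

Lemma ae_Rintegral0 y : measurable_fun setT y ->
  {ae P, forall x, y x = 0} -> E y = 0.
Proof.
by move=> my y0; rewrite (@ae_Rintegral y (cst 0))//; exact: RintegralT_cst.
Qed.

Lemma Rintegral_sum n (y : 'I_n -> T -> R) : (forall i, L1 (y i)) ->
  E (fun x => \sum_(i < n) y i x) = \sum_(i < n) E (y i).
Proof.
elim: n y => [|n IH] y iy.
  rewrite big_ord0 -[RHS]RintegralT_cst; apply: eq_Rintegral => x _.
  by rewrite big_ord0.
rewrite big_ord_recl -IH// -RintegralD//.
- by apply: eq_Rintegral => x _; rewrite big_ord_recl.
- exact: iy.
- by apply: L1_sum.
Qed.

Lemma EFin_Rintegral y : L1 y -> (E y)%:E = (\int[P]_x (y x)%:E)%E.
Proof. by move=> iy; rewrite fineK//; exact: integrable_fin_num. Qed.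

(** Nonnegativity of the variance. *)
Lemma sqr_Rintegral_le y : L2 y -> E y ^+ 2 <= E (fun x => y x ^+ 2).
Proof.
move=> y2; set m := E y.
have iy := L2_L1 y2.
have : 0 <= E (fun x => (y x - m) ^+ 2) by apply: Rintegral_ge0 => x _; exact: sqr_ge0.
have -> : E (fun x => (y x - m) ^+ 2) = E (fun x => (y x ^+ 2 - (2 * m) * y x) + m ^+ 2).
  by apply: eq_Rintegral => x _; ring.
have i2 := proj2 y2; have iZ := L1Z (2 * m) iy.
rewrite RintegralD//; [|exact: L1B|exact: (L1_cst (m ^+ 2))].
rewrite RintegralB//.
by rewrite RintegralZl// RintegralT_cst -/m; lra.
Qed.

Lemma Rintegral_norm_eq0 y : L1 y -> E (fun x => `|y x|) = 0 ->
  {ae P, forall x, y x = 0}.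
Proof.
move=> iy y0; have : (\int[P]_x `|(EFin \o y) x| = 0)%E.
  by rewrite -[RHS]/(0%:E) -y0 EFin_Rintegral//; exact: L1_norm.
have my : measurable_fun setT (EFin \o y) by exact: measurable_int iy.
move=> /(ae_eq_integral_abs P measurableT my) h.
by apply: filterS h => x /(_ I) [].
Qed.

End real_integrals.

(** * Conditional expectation by resampling coordinates *)

Section resampling.
Context {R : realType} d (S : measurableType d) (n : nat).
Local Notation X := (n.-tuple S).

Definition mix (K : set 'I_n) (s t : X) : X :=
  [tuple if i \in K then tnth s i else tnth t i | i < n].

Lemma tnth_mix K s t i : tnth (mix K s t) i = if i \in K then tnth s i else tnth t i.
Proof. by rewrite tnth_mktuple. Qed.

Lemma measurable_mix K : measurable_fun setT (fun z : X * X => mix K z.1 z.2).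
Proof.
apply/measurable_fun_tnthP => i.
rewrite (_ : _ \o _ = fun z => if i \in K then tnth z.1 i else tnth z.2 i).
  by case: (i \in K); apply: (measurableT_comp (measurable_tnth i)).
by apply/funext => z; rewrite -tnth_mix.
Qed.

Lemma mix_mixl K s t u : mix K (mix K s t) u = mix K s u.
Proof. by apply: eq_from_tnth => i; rewrite !tnth_mix; case: (i \in K). Qed.

Lemma mix_mix K L s t u : mix L (mix K s t) u = mix (K `&` L) s (mix L t u).
Proof.
apply: eq_from_tnth => i; rewrite !tnth_mix in_setI.
by case: (i \in L); case: (i \in K).
Qed.

Lemma mix_setT s t : mix setT s t = s.
Proof. by apply: eq_from_tnth => i; rewrite !tnth_mix in_setT. Qed.

Lemma mix_set0 s t : mix set0 s t = t.
Proof. by apply: eq_from_tnth => i; rewrite !tnth_mix in_set0. Qed.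

Variable mu : probability X R.
(* This is where independence enters: it holds for a product measure. *)
Hypothesis mixP : forall K, preserves (mu \x mu)%E mu (fun z : X * X => mix K z.1 z.2).
Implicit Types (y z : X -> R) (K L : set 'I_n).
Local Notation E y := (\int[mu]_x y x).
Local Notation L1 := (L1 mu).
Local Notation L2 := (L2 mu).

(** The coordinates in [K] are frozen and the others integrated out. Where the section in [t] is not
    integrable the value has no meaning, so linearity is claimed almost everywhere only, while
    invariance under [mix K] holds at every point. *)
Definition cexp K y (s : X) : R := \int[mu]_t y (mix K s t).

Let F K y := fubini_F mu (fun z : X * X => (y (mix K z.1 z.2))%:E).

Let imix K y : L1 y -> (mu \x mu)%E.-integrable setT
  (fun z : X * X => (y (mix K z.1 z.2))%:E).
Proof.
move=> iy; have [_ h] := preserves_integrable (mixP K) (measurable_int mu iy).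
exact: h.
Qed.

Lemma cexp_section K y : L1 y ->
  {ae mu, forall s, L1 (fun t => y (mix K s t))}.
Proof. by move=> iy; exact: (ae_integrable1 (imix K iy)). Qed.

Lemma measurable_cexp K y : L1 y -> measurable_fun setT (cexp K y).
Proof.
move=> iy; have /measurable_int mF := integrable_fubini_F (imix K iy).
exact: (measurableT_comp _ mF).
Qed.

Let cexpF K y : L1 y -> {ae mu, forall s, (cexp K y s)%:E = F K y s}.
Proof.
by move=> /(cexp_section K); apply: filterS => s iy; rewrite /cexp EFin_Rintegral.
Qed.

Lemma L1_cexp K y : L1 y -> L1 (cexp K y).
Proof.
move=> iy; have iF := integrable_fubini_F (imix K iy).
have mc : measurable_fun setT (EFin \o cexp K y).
  apply/measurable_EFinP; exact: (measurable_cexp K iy).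
(* Infinite values are sent to 0 by [fine], so the integrability that Fubini gives for [F K y]
   passes to [cexp K y]. *)
have H (a : \bar R) : (`|(fine a)%:E| <= `|a|)%E by case: a => [r| |] //=; rewrite ?leey.
by apply: (le_integrable _ mc _ iF) => // s _; exact: H.
Qed.

(** By Fubini the left side integrates [y (mix K s t)] over both tuples, and the mixed tuple has law
    [mu]. *)
Lemma Rintegral_cexp K y : L1 y -> E (cexp K y) = E y.
Proof.
move=> iy; congr fine; have iF := integrable_fubini_F (imix K iy).
transitivity (\int[mu]_s F K y s)%E.
  apply: ae_eq_integral => //; first by apply/measurable_EFinP; exact: (measurable_cexp K iy).
    exact: measurable_int iF.
  by apply: filterS (cexpF K iy) => s.
rewrite (integral12_prod_meas1 (imix K iy)).
exact: (preserves_integral (mixP K) iy).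
Qed.

(** The function depends on the coordinates in [K] only; this stands in for measurability with
    respect to them. *)
Definition mix_invariant K y := forall s t, y (mix K s t) = y s.

Lemma cexp_invariant K y : mix_invariant K (cexp K y).
Proof. by move=> s t; apply: eq_Rintegral => u _; rewrite mix_mixl. Qed.

Lemma cexp_id K y : mix_invariant K y -> cexp K y = y.
Proof.
move=> yK; apply/funext => s; rewrite -[RHS](RintegralT_cst mu).
by apply: eq_Rintegral => t _; rewrite yK.
Qed.

Lemma cexp_setT y : cexp setT y = y.
Proof. by apply: cexp_id => s t; rewrite mix_setT. Qed.

Lemma cexp_set0 y s : cexp set0 y s = E y.
Proof. by apply: eq_Rintegral => t _; rewrite mix_set0. Qed.

Lemma cexpD K y z : L1 y -> L1 z ->
  {ae mu, forall s, cexp K (fun x => y x + z x) s = cexp K y s + cexp K z s}.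
Proof.
move=> /(cexp_section K) iy /(cexp_section K); apply: filterS2 iy => s iy iz.
by rewrite /cexp RintegralD.
Qed.

Lemma cexpB K y z : L1 y -> L1 z ->
  {ae mu, forall s, cexp K (fun x => y x - z x) s = cexp K y s - cexp K z s}.
Proof.
move=> /(cexp_section K) iy /(cexp_section K); apply: filterS2 iy => s iy iz.
by rewrite /cexp RintegralB.
Qed.

Lemma cexpZ K r y : L1 y ->
  {ae mu, forall s, cexp K (fun x => r * y x) s = r * cexp K y s}.
Proof.
move=> /(cexp_section K); apply: filterS => s iy.
by rewrite /cexp RintegralZl.
Qed.

Lemma cexpM K y z : L1 y -> mix_invariant K z ->
  {ae mu, forall s, cexp K (fun x => y x * z x) s = cexp K y s * z s}.
Proof.
move=> /(cexp_section K) iy zK; apply: filterS iy => s iy.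
rewrite /cexp -RintegralZr//; apply: eq_Rintegral => t _.
by rewrite zK.
Qed.

(** Tower property for arbitrary, not just nested, sets of coordinates. By [mix_mix] the double
    resampling is [mix (K]&[L) s] applied to a tuple [mix L t u], which again has law [mu]. *)
Lemma cexp_cexp K L y : L1 y ->
  {ae mu, forall s, cexp K (cexp L y) s = cexp (K `&` L) y s}.
Proof.
move=> /(cexp_section (K `&` L)); apply: filterS => s iy.
rewrite -[RHS]/(E (fun t => y (mix (K `&` L) s t))) -(Rintegral_cexp L iy).
by apply: eq_Rintegral => u _; apply: eq_Rintegral => t _; rewrite mix_mix.
Qed.

Lemma le_norm_cexp K y : L1 y ->
  {ae mu, forall s, `|cexp K y s| <= cexp K (fun x => `|y x|) s}.
Proof.
move=> /(cexp_section K); apply: filterS => s iy.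
exact: le_normr_Rintegral.
Qed.

(** Conditional expectation contracts the L1 norm, so that of [y - z] has norm 0. *)
Lemma ae_cexp K y z : L1 y -> L1 z -> {ae mu, forall s, y s = z s} ->
  {ae mu, forall s, cexp K y s = cexp K z s}.
Proof.
move=> iy iz yz; have iyz := L1B iy iz.
have : {ae mu, forall s, cexp K (fun x => y x - z x) s = 0}.
  have ic := L1_cexp K iyz; apply: Rintegral_norm_eq0 => //.
  apply/eqP; rewrite eq_le Rintegral_ge0 // andbT.
  apply: (@le_trans _ _ (E (cexp K (fun x => `|y x - z x|)))).
    apply: ae_le_Rintegral; [exact: L1_norm|exact/L1_cexp/L1_norm|exact: le_norm_cexp].
  rewrite Rintegral_cexp; last exact: L1_norm.
  rewrite ae_Rintegral0//; first exact: L1_measurable (L1_norm iyz).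
  by apply: filterS yz => s ->; rewrite subrr normr0.
apply: filterS2 (cexpB K iy iz) => s -> /eqP.
by rewrite subr_eq0 => /eqP.
Qed.

Lemma sqr_cexp_le K y : L2 y ->
  {ae mu, forall s, cexp K y s ^+ 2 <= cexp K (fun x => y x ^+ 2) s}.
Proof.
move=> y2; have h1 := cexp_section K (L2_L1 y2); have h2 := cexp_section K (proj2 y2).
apply: filterS2 h1 h2 => s i1 i2; apply: sqr_Rintegral_le; split => //.
exact: L1_measurable i1.
Qed.

Lemma L2_cexp K y : L2 y -> L2 (cexp K y).
Proof.
move=> y2; have mc := measurable_cexp K (L2_L1 y2); split => //.
have ic := L1_cexp K (proj2 y2).
have m2 : measurable_fun setT (fun s => cexp K y s ^+ 2) by exact: measurable_funX.
(* The conditional Jensen inequality holds almost everywhere, but [L1_le] wants domination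
   everywhere: the minimum is dominated at every point and agrees almost everywhere with the
   square. *)
have : L1 (fun s => Num.min (cexp K y s ^+ 2) (cexp K (fun x => y x ^+ 2) s)).
  apply: (L1_le _ _ ic) => [|s].
    by apply: measurable_minr => //; exact: L1_measurable ic.
  have c0 : 0 <= cexp K (fun x => y x ^+ 2) s.
    by apply: Rintegral_ge0 => t _; exact: sqr_ge0.
  by rewrite !ger0_norm ?ge_min ?lexx ?orbT// le_min sqr_ge0.
apply: ae_L1 => //; apply: filterS (sqr_cexp_le K y2) => s h.
exact: min_idPl.
Qed.

Lemma Rintegral_sqr_cexp K y : L2 y ->
  E (fun s => cexp K y s ^+ 2) <= E (fun s => y s ^+ 2).
Proof.
move=> y2; rewrite -(Rintegral_cexp K (proj2 y2)); apply: ae_le_Rintegral.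
- exact: (proj2 (L2_cexp K y2)).
- exact/L1_cexp/(proj2 y2).
- exact: sqr_cexp_le.
Qed.

Lemma cexp_bounded K y (M : R) : measurable_fun setT y -> (forall x, `|y x| <= M) ->
  forall s, `|cexp K y s| <= M.
Proof.
move=> my yM s.
have iy : L1 (fun t => y (mix K s t)).
  apply: (L1_bounded _ (M := M)) => //.
  apply: measurableT_comp => //.
  exact: (measurable_fun_pair2 s (measurable_mix K)).
apply: (le_trans (le_normr_Rintegral _ iy)) => //.
rewrite -[leRHS](RintegralT_cst mu); apply: le_Rintegral => //.
- exact: L1_norm.
- exact: (L1_cst mu M).
Qed.

(** Both sides have the integral of [cexp K y * cexp K z], after conditioning and pulling out the
    invariant factor. *)
Lemma cexp_selfadjoint K y z : L1 y -> L1 z ->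
  L1 (fun x => y x * cexp K z x) -> L1 (fun x => cexp K y x * z x) ->
  E (fun x => y x * cexp K z x) = E (fun x => cexp K y x * z x).
Proof.
move=> iy iz iyz izy.
have izy' : L1 (fun x => z x * cexp K y x) by under eq_fun do rewrite mulrC.
have -> : E (fun x => cexp K y x * z x) = E (fun x => z x * cexp K y x).
  by apply: eq_Rintegral => x _; rewrite mulrC.
rewrite -(Rintegral_cexp K iyz) -(Rintegral_cexp K izy').
apply: ae_Rintegral; [exact: measurable_cexp iyz|exact: measurable_cexp izy'|].
have h1 := cexpM iy (@cexp_invariant K z); have h2 := cexpM iz (@cexp_invariant K y).
by apply: filterS2 h1 h2 => s -> ->; rewrite mulrC.
Qed.

End resampling.

(** * Covariance identity and Efron-Stein inequality *)

Section difference_operators.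
Context {R : realType} d (S : measurableType d) (n : nat).
Variable mu : probability (n.-tuple S) R.
Hypothesis mixP : forall K, preserves (mu \x mu)%E mu
  (fun z : n.-tuple S * n.-tuple S => mix K z.1 z.2).
Implicit Types (y z : n.-tuple S -> R) (K L : set 'I_n) (i : 'I_n).
Local Notation E y := (\int[mu]_x y x).
Local Notation L1 := (L1 mu).
Local Notation L2 := (L2 mu).
Local Notation cexp := (cexp mu).

Definition cexp_except i := cexp [set k | k != i].
Definition diff_op i y s := y s - cexp_except i y s.
Definition mart_diff i y := cexp [set k | (k <= i)%N] (diff_op i y).

(** Conditioning on the first [m] variables. Indices start at 0, so conditioning on F_i is
    [pre i.+1]. *)
Let pre (m : nat) := cexp [set k : 'I_n | (k < m)%N].

Lemma L1_diff_op i y : L1 y -> L1 (diff_op i y).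
Proof. by move=> iy; apply: L1B => //; exact: L1_cexp. Qed.

Lemma L2_diff_op i y : L2 y -> L2 (diff_op i y).
Proof. by move=> iy; apply: L2B => //; exact: L2_cexp. Qed.

Lemma L1_mart_diff i y : L1 y -> L1 (mart_diff i y).
Proof. by move=> iy; apply: L1_cexp => //; exact: L1_diff_op. Qed.

Lemma L2_mart_diff i y : L2 (diff_op i y) -> L2 (mart_diff i y).
Proof. exact: L2_cexp. Qed.

(** By the tower property, since the indices [k <= i] with [k != i] are those with [k < i]. This
    justifies the name martingale difference. *)
Let mart_diffE i y : L1 y ->
  {ae mu, forall s, mart_diff i y s = pre i.+1 y s - pre i y s}.
Proof.
move=> iy; have iey := L1_cexp mixP [set k | k != i] iy.
have h1 := cexpB mixP [set k : 'I_n | (k <= i)%N] iy iey.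
have h2 := cexp_cexp mixP [set k : 'I_n | (k <= i)%N] [set k | k != i] iy.
apply: filterS2 h1 h2 => s; rewrite /mart_diff /diff_op /cexp_except => -> ->.
congr (_ - cexp _ y s); apply/seteqP; split => k /=.
  by case=> ki /eqP ik; rewrite ltn_neqAle ki andbT; apply/eqP => /val_inj.
by rewrite ltn_neqAle => /andP[ki ->]; split => //; apply: contraNneq ki => ->.
Qed.

(** The sum telescopes from conditioning on nothing to conditioning on every coordinate. *)
Lemma sum_mart_diff y : L1 y ->
  {ae mu, forall s, \sum_(i < n) mart_diff i y s = y s - E y}.
Proof.
move=> iy; have : {ae mu, forall s i, mart_diff i y s = pre i.+1 y s - pre i y s}.
  by apply: filter_forall => i; exact: mart_diffE.
apply: filterS => s H.
rewrite (eq_bigr (fun i : 'I_n => pre i.+1 y s - pre i y s)); last by move=> i _; exact: H.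
rewrite -(big_mkord xpredT (fun m => pre m.+1 y s - pre m y s)) telescope_sumr//.
rewrite /pre (_ : [set k : 'I_n | (k < n)%N] = setT) ?cexp_setT; last first.
  by apply/seteqP; split => k //= _; exact: ltn_ord.
by rewrite (_ : [set k : 'I_n | (k < 0)%N] = set0) ?cexp_set0//; apply/seteqP; split.
Qed.

(** Once index [i] is removed, the first [i] and the first [i.+1] indices form the same set, so both
    terms of [mart_diffE] have the same conditional expectation. *)
Lemma cexp_except_mart_diff i y : L1 y ->
  {ae mu, forall s, cexp_except i (mart_diff i y) s = 0}.
Proof.
move=> iy; have i1 : L1 (pre i.+1 y) by exact: L1_cexp.
have i0 : L1 (pre i y) by exact: L1_cexp.
have h := ae_cexp mixP [set k | k != i] (L1_mart_diff i iy) (L1B i1 i0) (mart_diffE i iy).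
have hB := cexpB mixP [set k | k != i] i1 i0.
have h1 := cexp_cexp mixP [set k | k != i] [set k : 'I_n | (k < i.+1)%N] iy.
have h0 := cexp_cexp mixP [set k | k != i] [set k : 'I_n | (k < i)%N] iy.
apply: filterS2 (filterI h hB) (filterI h1 h0) => s [e1 e2] [e3 e4].
rewrite /cexp_except e1 e2 e3 e4; apply/eqP; rewrite subr_eq0; apply/eqP.
congr (cexp _ y s); apply/seteqP; split => k /= [ki].
  by rewrite ltnS leq_eqVlt => /orP[/eqP/val_inj ik|//]; rewrite ik eqxx in ki.
by move=> /ltnW; rewrite ltnS.
Qed.

(** Self-adjointness moves E_i from [z] onto the martingale difference, where it gives 0. *)
Lemma Rintegral_mart_diffM i y z : L1 y -> L2 (mart_diff i y) -> L2 z ->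
  E (fun s => mart_diff i y s * diff_op i z s) = E (fun s => mart_diff i y s * z s).
Proof.
move=> iy b2 z2; have e2 := L2_cexp mixP [set k | k != i] z2.
have -> : E (fun s => mart_diff i y s * diff_op i z s) =
    E (fun s => mart_diff i y s * z s - mart_diff i y s * cexp_except i z s).
  by apply: eq_Rintegral => s _; rewrite mulrBr.
have i1 := L2M b2 z2; have i2 := L2M b2 e2.
have i3 := L2M (L2_cexp mixP [set k | k != i] b2) z2.
rewrite RintegralB// (cexp_selfadjoint mixP (L1_mart_diff i iy) (L2_L1 z2) i2 i3).
rewrite [X in _ - X]ae_Rintegral0 ?subr0//; first exact: L1_measurable i3.
by apply: filterS (cexp_except_mart_diff i iy) => s; rewrite /cexp_except => ->; rewrite mul0r.
Qed.

(** The covariance identity. Asking only [L1 y] lets Efron-Stein apply to [Z] and [Zbar], not known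
    in advance to be square-integrable. *)
Lemma Rintegral_center_mul y z : L1 y -> (forall i, L2 (mart_diff i y)) -> L2 z ->
  E (fun s => (y s - E y) * z s) =
  \sum_(i < n) E (fun s => mart_diff i y s * diff_op i z s).
Proof.
move=> iy b2 z2; under eq_bigr do rewrite Rintegral_mart_diffM//.
rewrite -Rintegral_sum; last by move=> i; exact: L2M.
have mz := L2_measurable z2; have my := L1_measurable iy.
apply: ae_Rintegral.
- by apply: measurable_funM => //; exact: measurable_funB.
- by apply: (L1_measurable (P := mu)); apply: L1_sum => i; exact: L2M.
- by apply: filterS (sum_mart_diff iy) => s <-; rewrite mulr_suml.
Qed.

Theorem efron_stein y : L1 y -> (forall i, L2 (diff_op i y)) ->
  L2 y /\ E (fun s => (y s - E y) ^+ 2) <= \sum_(i < n) E (fun s => diff_op i y s ^+ 2).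
Proof.
move=> iy d2; have b2 i := L2_mart_diff (d2 i).
have my := L1_measurable iy.
have y02 : L2 (fun s => y s - E y).
  apply: ae_L2 (sum_mart_diff iy) (L2_sum b2).
  exact: measurable_funB.
have y2 : L2 y.
  rewrite (_ : y = fun s => y s - E y + cst (E y) s); last by apply/funext => s; rewrite subrK.
  by apply: L2D => //; exact: L2_cst.
split => //.
have -> : E (fun s => (y s - E y) ^+ 2) = E (fun s => (y s - E y) * y s).
  rewrite (@eq_Rintegral _ _ _ mu setT (fun s => (y s - E y) * y s - E y * (y s - E y))); last first.
    by move=> s _; ring.
  rewrite RintegralB//; [|exact: L2M|exact/L1Z/L2_L1].
  rewrite RintegralZl//; last exact/L2_L1.
  rewrite RintegralB//; last exact: L1_cst.
  by rewrite RintegralT_cst subrr mulr0 subr0.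
rewrite Rintegral_center_mul//; apply: ler_sum => i _.
have := Rintegral_sqr_cexp mixP [set k : 'I_n | (k <= i)%N] (d2 i).
rewrite -/(mart_diff i y) => bd.
have i1 := proj2 (b2 i); have i2 := proj2 (d2 i); have i12 := L2M (b2 i) (d2 i).
(* With A the martingale difference and D the difference operator, [2 * E[A D] <= E[A^2] + E[D^2] <=
   2 * E[D^2]], the last step because A is a conditional expectation of D. *)
have : 0 <= E (fun s => (mart_diff i y s - diff_op i y s) ^+ 2).
  by apply: Rintegral_ge0 => s _; exact: sqr_ge0.
rewrite (@eq_Rintegral _ _ _ mu setT (fun s => mart_diff i y s ^+ 2 + diff_op i y s ^+ 2
    - 2 * (mart_diff i y s * diff_op i y s))); last by move=> s _; ring.
rewrite RintegralB//; [|exact: L1D|exact: L1Z].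
rewrite RintegralD// RintegralZl//.
by lra.
Qed.

End difference_operators.

(** * Stein's method on tuples *)

Section stein_bound.
Context {R : realType} d (S : measurableType d) (n : nat).
Variable mu : probability (n.-tuple S) R.
Hypothesis mixP : forall K, preserves (mu \x mu)%E mu
  (fun z : n.-tuple S * n.-tuple S => mix K z.1 z.2).
Local Notation E y := (\int[mu]_x y x).
Local Notation L1 := (L1 mu).
Local Notation L2 := (L2 mu).
Local Notation cexp := (cexp mu).
Local Notation cexp_except := (cexp_except mu).
Local Notation diff_op := (diff_op mu).
Local Notation mart_diff := (mart_diff mu).

Lemma Rintegral_BBD (a b c e : n.-tuple S -> R) : L1 a -> L1 b -> L1 c -> L1 e ->
  E (fun x => a x - b x - c x + e x) = E a - E b - E c + E e.
Proof.
move=> ia ib ic ie; have iab := L1B ia ib; have iabc := L1B iab ic.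
by rewrite RintegralD// RintegralB// RintegralB.
Qed.

Variable f : n.-tuple S -> R.
Hypothesis f2 : L2 f.

(** The variable [Z] on tuples; [stein_kernel_abs] is likewise [Zbar]. *)
Definition stein_kernel s := \sum_(i < n) diff_op i f s * mart_diff i f s.

Definition stein_kernel_abs_summand i :=
  diff_op i (fun t => diff_op i f t *
    (`|mart_diff i f t| + cexp_except i (fun u => `|mart_diff i f u|) t)).

Definition stein_kernel_abs s := \sum_(i < n) stein_kernel_abs_summand i s.

Local Notation A i := (mart_diff i f).
Local Notation absA i := (fun u => `|mart_diff i f u|).

Let if1 : L1 f. Proof. exact: L2_L1. Qed.
Let D2 i : L2 (diff_op i f). Proof. exact: L2_diff_op. Qed.
Let A2 i : L2 (A i). Proof. exact: L2_mart_diff. Qed.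
Let absA2 i : L2 (absA i). Proof. exact: L2_norm. Qed.
Let eA2 i : L2 (cexp_except i (absA i)). Proof. exact: L2_cexp. Qed.
Let ef2 i : L2 (cexp_except i f). Proof. exact: L2_cexp. Qed.

Lemma L1_stein_kernel : L1 stein_kernel.
Proof. by apply: L1_sum => i; exact: L2M. Qed.

Let W1 i : L1 (fun t => diff_op i f t * (`|A i t| + cexp_except i (absA i) t)).
Proof. by apply: L2M => //; exact: L2D. Qed.

Lemma L1_stein_kernel_abs_summand i : L1 (stein_kernel_abs_summand i).
Proof. exact: L1_diff_op. Qed.

Lemma L1_stein_kernel_abs : L1 stein_kernel_abs.
Proof. by apply: L1_sum => i; exact: L1_stein_kernel_abs_summand. Qed.

(** E_i of [diff_op i f * E_i|A i|] vanishes, and the two products [E_i|A i| * E_i f] cancel. The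
    resulting four terms match, by self-adjointness, those of the weighted remainder in [norm_V]. *)
Lemma stein_kernel_abs_summandE i :
  {ae mu, forall s, stein_kernel_abs_summand i s =
    `|A i s| * f s - cexp_except i (fun t => `|A i t| * f t) s
    - `|A i s| * cexp_except i f s + cexp_except i (absA i) s * f s}.
Proof.
set K := [set k | k != i].
have iDA : L1 (fun t => diff_op i f t * `|A i t|) by exact: L2M.
have iDeA : L1 (fun t => diff_op i f t * cexp_except i (absA i) t) by exact: L2M.
have iAf : L1 (fun t => `|A i t| * f t) by exact: L2M.
have iAef : L1 (fun t => `|A i t| * cexp_except i f t) by exact: L2M.
have eW : {ae mu, forall s,
    cexp_except i (fun t => diff_op i f t * (`|A i t| + cexp_except i (absA i) t)) s
    = cexp_except i (fun t => diff_op i f t * `|A i t|) s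
      + cexp_except i (fun t => diff_op i f t * cexp_except i (absA i) t) s}.
  have := cexpD mixP K iDA iDeA.
  by under [X in cexp K X]eq_fun do rewrite -mulrDr.
have eDA : {ae mu, forall s, cexp_except i (fun t => diff_op i f t * `|A i t|) s =
    cexp_except i (fun t => `|A i t| * f t) s
    - cexp_except i (fun t => `|A i t| * cexp_except i f t) s}.
  have := cexpB mixP K iAf iAef.
  rewrite (_ : (fun x => _ - _) = fun t => diff_op i f t * `|A i t|)//.
  by apply/funext => t; rewrite /diff_op; ring.
have eDeA : {ae mu, forall s,
    cexp_except i (fun t => diff_op i f t * cexp_except i (absA i) t) s =
    cexp_except i (diff_op i f) s * cexp_except i (absA i) s}.
  exact: (cexpM mixP (L2_L1 (D2 i)) (@cexp_invariant _ _ _ _ mu K (absA i))).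
have eAef : {ae mu, forall s,
    cexp_except i (fun t => `|A i t| * cexp_except i f t) s =
    cexp_except i (absA i) s * cexp_except i f s}.
  exact: (cexpM mixP (L2_L1 (absA2 i)) (@cexp_invariant _ _ _ _ mu K f)).
have eD : {ae mu, forall s, cexp_except i (diff_op i f) s =
    cexp_except i f s - cexp_except i (cexp_except i f) s}.
  exact: (cexpB mixP K if1 (L2_L1 (ef2 i))).
have eef : {ae mu, forall s, cexp_except i (cexp_except i f) s = cexp_except i f s}.
  by have := cexp_cexp mixP K K if1; rewrite setIid.
apply: filterS2 (filterI eW eDA) (filterI (filterI eDeA eAef) (filterI eD eef)).
move=> s [h1 h2] [[h3 h4] [h5 h6]].
rewrite /stein_kernel_abs_summand {1}/diff_op h1 h2 h4 h3 h5 h6 subrr mul0r.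
rewrite /diff_op; ring.
Qed.

Context dN (TN : measurableType dN) (Q : probability TN R).
Variable N : {RV Q >-> R}.
Hypothesis stdN : standard_normal N.
Variables (tau x : R).
Hypothesis tau0 : 0 <= tau.
Let c := normal_cdf x.

(** From here on [phi] is the normalized variable, not the density; [gam], [h] and [kap] are the
    Stein solution, its derivative and the centred [stein_osc], evaluated at it. *)
Let phi s := tau * f s.
Let gam s := stein_sol x (phi s).
Let h s := stein_sol' x (phi s).
Let kap s := stein_osc x (phi s) - c.

Let phi2 : L2 phi. Proof. exact: L2Z. Qed.
Let mphi : measurable_fun setT phi. Proof. exact: L2_measurable phi2. Qed.
Let mkap : measurable_fun setT kap.
Proof.
apply: measurable_funB => //.
by apply: measurableT_comp mphi; exact: measurable_stein_osc stdN x.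
Qed.
Let mh : measurable_fun setT h.
Proof. by apply: measurableT_comp mphi; exact: measurable_stein_sol' stdN x. Qed.
Let kap1 s : `|kap s| <= 1. Proof. exact: stein_osc_le1 stdN x (phi s). Qed.
Let h1 s : `|h s| <= 1. Proof. exact: stein_sol'_le1 stdN x (phi s). Qed.

Let gam2 : L2 gam.
Proof.
have mg : measurable_fun setT gam.
  by apply: measurableT_comp mphi; exact: measurable_stein_sol stdN x.
apply: (L2_le mg _ (L2D (L2_norm phi2) (L2_cst mu `|stein_sol x 0|))) => s.
rewrite [X in _ <= X]ger0_norm ?addr_ge0//.
have := stein_sol_lipschitz stdN x (phi s) 0; rewrite subr0 => le0.
by rewrite /gam -lerBlDr (le_trans (lerB_dist _ _)).
Qed.

Let kapL1 : L1 kap. Proof. exact: L1_bounded mkap kap1. Qed.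
Let pk2 : L2 (fun s => phi s * kap s). Proof. exact: L2M_bounded mkap kap1. Qed.

(** The product [(phi s - phi s') * (kap s - kap s')], expanded and averaged over the tuple [s']
    obtained from [s] by resampling coordinate [i]. *)
Let V i s := phi s * kap s - phi s * cexp_except i kap s - kap s * cexp_except i phi s
  + cexp_except i (fun t => phi t * kap t) s.

Let V2 i : L2 (V i).
Proof.
have mek : measurable_fun setT (cexp_except i kap) by exact: measurable_cexp mixP _ _ kapL1.
have ek1 := cexp_bounded mu [set k | k != i] mkap kap1.
apply: L2D; last exact: L2_cexp.
apply: L2B; last first.
  under eq_fun do rewrite mulrC.
  by apply: L2M_bounded mkap kap1; exact: L2_cexp.
by apply: L2B => //; exact: L2M_bounded mek ek1.
Qed.

(** Both sides are integrals over the resampled coordinate, and [stein_sol_remainder] compares the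
    integrands. *)
Let remainder_le i : {ae mu, forall s,
  `|h s * (phi s - cexp_except i phi s) - diff_op i gam s| <= V i s}.
Proof.
set K := [set k | k != i].
have s1 := cexp_section mixP K (L2_L1 phi2); have s2 := cexp_section mixP K (L2_L1 gam2).
have s3 := cexp_section mixP K kapL1; have s4 := cexp_section mixP K (L2_L1 pk2).
apply: filterS2 (filterI s1 s2) (filterI s3 s4) => s [i1 i2] [i3 i4].
have ->: h s * (phi s - cexp_except i phi s) - diff_op i gam s =
  E (fun t => h s * (phi s - phi (mix K s t)) - (gam s - gam (mix K s t))).
  have j1 : L1 (fun t => phi s - phi (mix K s t)) by apply: L1B => //; exact: (L1_cst mu (phi s)).
  have j2 : L1 (fun t => gam s - gam (mix K s t)) by apply: L1B => //; exact: (L1_cst mu (gam s)).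
  rewrite [RHS]RintegralB//; last exact: L1Z.
  rewrite [in RHS]RintegralZl// [in RHS]RintegralB//; last exact: (L1_cst mu (phi s)).
  rewrite [X in _ = _ - X]RintegralB//; last exact: (L1_cst mu (gam s)).
  by rewrite !RintegralT_cst; exact: erefl.
have ->: V i s = E (fun t => phi s * kap s - phi s * kap (mix K s t)
    - kap s * phi (mix K s t) + phi (mix K s t) * kap (mix K s t)).
  rewrite Rintegral_BBD; [|exact: (L1_cst mu (phi s * kap s))|exact: L1Z|exact: L1Z|exact: i4].
  by rewrite RintegralT_cst (RintegralZl _ measurableT i3) (RintegralZl _ measurableT i1); exact: erefl.
have j1 : L1 (fun t => h s * (phi s - phi (mix K s t)) - (gam s - gam (mix K s t))).
  apply: L1B; last by apply: L1B => //; exact: (L1_cst mu (gam s)).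
  by apply/L1Z/L1B => //; exact: (L1_cst mu (phi s)).
apply: (le_trans (le_normr_Rintegral _ j1)) => //.
apply: le_Rintegral => //; first exact: L1_norm.
  apply: L1D => //; apply: L1B; last exact: L1Z.
  by apply: L1B; [exact: (L1_cst mu (phi s * kap s))|exact: L1Z].
move=> t _; apply: (le_trans (stein_sol_remainder stdN x (phi s) (phi (mix K s t)))).
by rewrite /kap le_eqVlt; apply/orP; left; apply/eqP; ring.
Qed.

(** Self-adjointness moves E_i off [kap] and off [phi * kap] onto the weight; what then multiplies
    [kap] is [tau] times the expansion in [stein_kernel_abs_summandE]. *)
Let norm_V i : E (fun s => `|A i s| * V i s) =
  tau * E (fun s => kap s * stein_kernel_abs_summand i s).
Proof.
set K := [set k | k != i].
have mek : measurable_fun setT (cexp_except i kap) by exact: measurable_cexp mixP _ _ kapL1.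
have ek1 := cexp_bounded mu K mkap kap1.
have iAp : L1 (fun s => `|A i s| * phi s) by exact: L2M.
have iAf : L1 (fun s => `|A i s| * f s) by exact: L2M.
have t1 : L1 (fun s => `|A i s| * (phi s * kap s)) by exact: L2M.
have t2 : L1 (fun s => `|A i s| * phi s * cexp_except i kap s) by exact: L1M_bounded mek ek1.
have t2' : L1 (fun s => cexp_except i (fun t => `|A i t| * phi t) s * kap s).
  by apply: L1M_bounded mkap kap1; exact: L1_cexp.
have t3 : L1 (fun s => `|A i s| * (kap s * cexp_except i phi s)).
  apply: L2M => //; under eq_fun do rewrite mulrC.
  by apply: L2M_bounded mkap kap1; exact: L2_cexp.
have t4 : L1 (fun s => `|A i s| * cexp_except i (fun t => phi t * kap t) s).
  by apply: L2M => //; exact: L2_cexp.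
have t4' : L1 (fun s => cexp_except i (absA i) s * (phi s * kap s)) by exact: L2M.
rewrite (@eq_Rintegral _ _ _ mu setT (fun s => `|A i s| * (phi s * kap s)
    - `|A i s| * phi s * cexp_except i kap s - `|A i s| * (kap s * cexp_except i phi s)
    + `|A i s| * cexp_except i (fun t => phi t * kap t) s)); last first.
  by move=> s _; rewrite /V; ring.
rewrite Rintegral_BBD//.
rewrite (cexp_selfadjoint mixP iAp kapL1 t2 t2').
rewrite (cexp_selfadjoint mixP (L2_L1 (absA2 i)) (L2_L1 pk2) t4 t4').
rewrite -Rintegral_BBD//.
have iW : L1 (fun s => kap s * stein_kernel_abs_summand i s).
  under eq_fun do rewrite mulrC.
  by apply: L1M_bounded mkap kap1; exact: L1_stein_kernel_abs_summand.
rewrite -RintegralZl//; apply: ae_Rintegral.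
- by apply: (L1_measurable (P := mu)); apply: L1D => //; apply: L1B => //; exact: L1B.
- exact: L1_measurable (L1Z tau iW).
have c1 : {ae mu, forall s, cexp_except i phi s = tau * cexp_except i f s}.
  exact: (cexpZ mixP K tau if1).
have c2 : {ae mu, forall s, cexp_except i (fun t => `|A i t| * phi t) s =
    tau * cexp_except i (fun t => `|A i t| * f t) s}.
  have := cexpZ mixP K tau iAf.
  by under [X in cexp K X]eq_fun do rewrite mulrCA.
apply: filterS2 (stein_kernel_abs_summandE i) (filterI c1 c2) => s -> [].
rewrite /cexp_except => -> ->.
by rewrite /phi; ring.
Qed.

Let summand_le i :
  `|E (fun s => A i s * (h s * (tau * diff_op i f s) - diff_op i gam s))|
  <= tau * E (fun s => kap s * stein_kernel_abs_summand i s).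
Proof.
rewrite -norm_V.
have hD2 : L2 (fun s => h s * (tau * diff_op i f s) - diff_op i gam s).
  apply: L2B; last exact: L2_diff_op.
  under eq_fun do rewrite mulrC.
  by apply: L2M_bounded mh h1; exact: L2Z.
have i1 := L2M (A2 i) hD2.
apply: (le_trans (le_normr_Rintegral _ i1)) => //.
apply: ae_le_Rintegral; [exact: L1_norm|exact: L2M|].
have c1 : {ae mu, forall s, cexp_except i phi s = tau * cexp_except i f s}.
  exact: (cexpZ mixP [set k | k != i] tau if1).
apply: filterS2 c1 (remainder_le i) => s c1 le.
rewrite normrM ler_wpM2l//; apply: le_trans le.
rewrite le_eqVlt; apply/orP; left; apply/eqP; congr (`|_ * _ - _|).
by rewrite c1 /phi /diff_op mulrBr.
Qed.

Let Rintegral_stein : E f = 0 ->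
  E (fun s => phi s * gam s) =
  tau * \sum_(i < n) E (fun s => A i s * diff_op i gam s).
Proof.
move=> f0; rewrite -Rintegral_center_mul// f0 -RintegralZl//; last first.
  by under eq_fun do rewrite subr0; exact: L2M.
by apply: eq_Rintegral => s _; rewrite subr0 mulrA.
Qed.

Lemma normal_cdf_sub_le : E f = 0 ->
  `|E (fun s => (phi s <= x)%R%:R) - c| <=
  E (fun s => `|1 - tau ^+ 2 * stein_kernel s|) +
  tau ^+ 2 * E (fun s => `|stein_kernel_abs s|).
Proof.
move=> f0.
have iind : L1 (fun s => (phi s <= x)%R%:R).
  apply: (L1_bounded _ (M := 1)) => [|s]; last by case: (phi s <= x); rewrite ?normr1 ?normr0.
  rewrite (_ : (fun s => _) = \1_(`]-oo, x]%classic : set R) \o phi).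
    by apply: measurableT_comp mphi; exact: measurable_indic.
  by apply/funext => s /=; rewrite indicE mem_setE in_itv.
have hL1 : L1 h by exact: L1_bounded mh h1.
have pg : L1 (fun s => phi s * gam s) by exact: L2M.
have iZ : L1 (fun s => h s * stein_kernel s).
  under eq_fun do rewrite mulrC.
  by apply: L1M_bounded mh h1; exact: L1_stein_kernel.
have iAD i : L1 (fun s => A i s * (h s * (tau * diff_op i f s))).
  apply: L2M => //; under eq_fun do rewrite mulrC.
  by apply: L2M_bounded mh h1; exact: L2Z.
have iAg i : L1 (fun s => A i s * diff_op i gam s).
  by apply: L2M => //; exact: L2_diff_op.
(* The Stein equation, integrated. *)
have e1 : E (fun s => (phi s <= x)%R%:R) - c = E h - E (fun s => phi s * gam s).
  rewrite -RintegralB// -[in LHS](RintegralT_cst mu c) -RintegralB//; last exact: (L1_cst mu c).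
  by apply: eq_Rintegral => s _; rewrite /h /stein_sol' -/(gam s) -/c; ring.
(* The part of [h] carried by the kernel is written as a sum over [i], to be matched term by term
   with the covariance identity for [gam]. *)
have e2 : E h = E (fun s => h s * (1 - tau ^+ 2 * stein_kernel s))
    + tau * \sum_(i < n) E (fun s => A i s * (h s * (tau * diff_op i f s))).
  rewrite -Rintegral_sum// -RintegralZl//; last exact: L1_sum.
  rewrite -RintegralD//.
  - apply: eq_Rintegral => s _.
    rewrite (eq_bigr (fun i => h s * tau * (diff_op i f s * A i s))); last by move=> i _; ring.
    by rewrite -mulr_sumr -/(stein_kernel s); ring.
  - by under eq_fun do rewrite mulrBr mulr1 mulrCA; apply: L1B => //; exact: L1Z.
  - by apply: L1Z; exact: L1_sum.
have -> : E (fun s => (phi s <= x)%R%:R) - c =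
    E (fun s => h s * (1 - tau ^+ 2 * stein_kernel s)) +
    tau * \sum_(i < n) E (fun s => A i s * (h s * (tau * diff_op i f s) - diff_op i gam s)).
  rewrite e1 e2 Rintegral_stein// -addrA -mulrBr -sumrB; congr (_ + _ * _).
  apply: eq_bigr => i _; rewrite -RintegralB; [|by []|exact: iAD|exact: iAg].
  by apply: eq_Rintegral => s _ /=; ring.
have i1Z : L1 (fun s => 1 - tau ^+ 2 * stein_kernel s).
  by apply: L1B; [exact: (L1_cst mu 1)|apply: L1Z; exact: L1_stein_kernel].
rewrite (le_trans (ler_normD _ _))// lerD//.
  have i2 : L1 (fun s => h s * (1 - tau ^+ 2 * stein_kernel s)).
    by under eq_fun do rewrite mulrC; exact: L1M_bounded mh h1.
  apply: (le_trans (le_normr_Rintegral _ i2)) => //.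
  apply: le_Rintegral => // [||s _]; [exact: L1_norm|exact: L1_norm|].
  by rewrite normrM ler_piMl.
rewrite normrM (ger0_norm tau0) expr2 -mulrA ler_wpM2l//.
apply: (le_trans (ler_norm_sum _ _ _)).
apply: (le_trans (ler_sum _ (fun i _ => summand_le i))).
have ikW i : L1 (fun s => kap s * stein_kernel_abs_summand i s).
  under eq_fun do rewrite mulrC.
  by apply: L1M_bounded mkap kap1; exact: L1_stein_kernel_abs_summand.
rewrite -mulr_sumr ler_wpM2l// -Rintegral_sum//.
apply: le_Rintegral => // [||s _]; [exact: L1_sum|exact/L1_norm/L1_stein_kernel_abs|].
by rewrite -mulr_sumr (le_trans (ler_norm _))// normrM ler_piMl.
Qed.

End stein_bound.

(** * The joint law and transfer to the probability space *)

Section boxes.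
Context {R : realType} d (S : measurableType d) (n : nat).

Definition box (A : 'I_n -> set S) : set (n.-tuple S) :=
  [set t | forall i, A i (tnth t i)].

Lemma measurable_box A : (forall i, measurable (A i)) -> measurable (box A).
Proof.
move=> mA; rewrite (_ : box A = \big[setI/setT]_(i < n) (@tnth _ S ^~ i @^-1` A i)).
  apply: bigsetI_measurable => i _; rewrite -[X in measurable X]setTI.
  exact: measurable_tnth.
rewrite -bigcap_seq; apply/seteqP; split => t /= tA.
  by move=> i _; exact: tA.
by move=> i; apply: tA => /=; rewrite mem_index_enum.
Qed.

(** Measurable boxes are stable under intersection, contain the whole space and generate the product
    sigma-algebra, so uniqueness of finite measures applies. *)
Lemma box_preserves d' (T : measurableType d') (m1 : {measure set T -> \bar R})
    (m2 : {measure set (n.-tuple S) -> \bar R}) (h : T -> n.-tuple S) :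
  measurable_fun setT h -> (m1 setT < +oo)%E ->
  (forall A, (forall i, measurable (A i)) -> m1 (h @^-1` box A) = m2 (box A)) ->
  preserves m1 m2 h.
Proof.
move=> mh m1oo m12; split => // B mB.
pose G : set (set (n.-tuple S)) := [set box A | A in [set A | forall i, measurable (A i)]].
have boxT : box (fun=> setT) = setT by apply/seteqP; split.
have GT : G setT by exists (fun=> setT).
rewrite -[LHS]/(pushforward m1 h B).
apply: (@measure_unique _ _ _ G (fun=> setT)) => //.
- apply/seteqP; split.
    apply: smallest_sub; first exact: smallest_sigma_algebra.
    rewrite -bigcup_seq => C [i /= _ [D mD <-]]; apply: sub_sigma_algebra.
    exists (fun j => if j == i then D else setT) => [j|]; first by case: ifP.
    rewrite setTI; apply/seteqP; split => t /=.
      by move=> /(_ i); rewrite eqxx.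
    by move=> Dt j; case: eqP => // ->.
  apply: smallest_sub; first exact: sigma_algebra_measurable.
  by move=> _ [A mA <-]; exact: measurable_box.
- move=> _ _ [A mA <-] [A' mA' <-]; exists (fun i => A i `&` A' i).
    by move=> i; exact: measurableI.
  apply/seteqP; split => t /=; first by move=> H; split => i; case: (H i).
  by move=> [H H'] i.
- by rewrite bigcup_const.
- by move=> _ [A mA <-]; exact: m12.
Qed.

End boxes.

(** * The law of the tuple of inputs and its invariance under mixing *)

Section joint_law.
Context {R : realType} d (T : measurableType d) (P : probability T R)
  d' (S : measurableType d') (n : nat) (X : 'I_n -> {RV P >-> S}).

Definition joint (w : T) : n.-tuple S := [tuple X i w | i < n].

Lemma measurable_joint : measurable_fun setT joint.
Proof.
apply/measurable_fun_tnthP => i; rewrite (_ : _ \o _ = X i)//.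
by apply/funext => w /=; rewrite tnth_mktuple.
Qed.

HB.instance Definition _ := isMeasurableFun.Build _ _ _ _ joint measurable_joint.

Definition law : probability (n.-tuple S) R := distribution P joint.

Lemma joint_preserves : preserves P law joint.
Proof. by split; first exact: measurable_joint. Qed.

Hypothesis indX : mutually_independent X.

Lemma law_box A : (forall i, measurable (A i)) ->
  law (box A) = (\prod_(i < n) P (X i @^-1` A i))%E.
Proof.
move=> mA; have := indX [set: 'I_n]%SET mA.
rewrite (eq_bigl xpredT); last by move=> i; rewrite inE.
move=> <-; congr (P _); apply/seteqP; split => w /= H i.
  by move=> _; have := H i; rewrite tnth_mktuple.
by rewrite tnth_mktuple; apply: H; rewrite /= inE.
Qed.

(** The preimage of a box is a product of two boxes, [A1] constraining the coordinates in [K] and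
    [A2] the others; by independence the probabilities multiply back coordinate by coordinate. *)
Lemma mix_law K : preserves (law \x law)%E law
  (fun z : n.-tuple S * n.-tuple S => mix K z.1 z.2).
Proof.
apply: box_preserves; first exact: measurable_mix.
  have E : (law \x law)%E setT = 1%E by exact: probability_setT.
  exact: (eq_ind_r (fun u => (u < +oo)%E) (ltry 1) E).
move=> A mA; pose A1 i := if i \in K then A i else setT.
pose A2 i := if i \in K then setT else A i.
have mA1 i : measurable (A1 i) by rewrite /A1; case: ifP.
have mA2 i : measurable (A2 i) by rewrite /A2; case: ifP.
rewrite (_ : _ @^-1` _ = box A1 `*` box A2); last first.
  apply/seteqP; split => -[s t] /=.
    move=> H; split => i; rewrite /A1 /A2; have := H i; rewrite tnth_mix /=.
      by case: ifP.
    by case: ifP.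
  by move=> [/= H1 H2] i; have := H1 i; have := H2 i; rewrite /A1 /A2 tnth_mix; case: ifP.
transitivity (law (box A1) * law (box A2))%E.
  by apply: product_measure1E; exact: measurable_box.
rewrite [LHS](f_equal2 (fun u v => (u * v)%E) (law_box mA1) (law_box mA2)).
rewrite [RHS](law_box mA) -big_split/=; apply: eq_bigr => i _; rewrite /A1 /A2.
by case: ifP => _; rewrite preimage_setT probability_setT ?mule1 ?mul1e.
Qed.

End joint_law.

(** * Almost sure uniqueness of conditional expectations *)

Section condexp_unique.
Context {R : realType} d (T : measurableType d) (P : probability T R).
Variable gen : set (set T).
Hypothesis mgen : gen `<=` measurable.
Local Notation G := <<s gen >>.

Lemma g_sigma_algebra_measurable : G `<=` measurable.
Proof. by apply: smallest_sub => //; exact: sigma_algebra_measurable. Qed.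

(** The set [A] where [W < W'] belongs to [G], so both versions have the same integral over it,
    although [W' - W] is positive there. *)
Lemma is_condexp_ltW_null Y W W' : is_condexp P G Y W -> is_condexp P G Y W' ->
  {ae P, forall w, ~ W w < W' w}.
Proof.
move=> [iY iW mW EW] [_ iW' mW' EW'].
pose TG := g_sigma_algebraType gen.
have gW : measurable_fun setT (W : TG -> R) by move=> _ B mB; rewrite setTI; exact: mW.
have gW' : measurable_fun setT (W' : TG -> R) by move=> _ B mB; rewrite setTI; exact: mW'.
pose A := [set w | 0 < W' w - W w].
have GA : G A.
  have gD : measurable_fun setT (fun w : TG => W' w - W w) by exact: measurable_funB.
  have := gD measurableT `]0, +oo[%classic (measurable_itv _).
  by rewrite setTI (_ : _ @^-1` _ = A)//; apply/seteqP; split => w /=; rewrite in_itv/= andbT.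
have mA := g_sigma_algebra_measurable GA.
have iD : L1 P (fun w => W' w - W w) by exact: L1B.
have iDA : P.-integrable A (fun w => (W' w - W w)%:E) by exact: integrableS iD.
have E0 : (\int[P]_(w in A) (W' w - W w)%:E = 0)%E.
  under eq_integral do rewrite EFinB.
  rewrite integralB//; [|exact: integrableS iW'|exact: integrableS iW].
  rewrite EW// EW'// subee//; apply: integrable_fin_num => //.
  exact: integrableS iY.
have : (\int[P]_(w in A) `|(W' w - W w)%:E| = 0)%E.
  rewrite -[RHS]E0; apply: eq_integral => w; rewrite inE => Aw.
  by rewrite gee0_abs// lee_fin ltW.
have mD : measurable_fun A (fun w => (W' w - W w)%:E) by exact: measurable_int iDA.
move=> /(ae_eq_integral_abs P mA mD); apply: filterS => w H WW.
have Aw : A w by rewrite /A/= subr_gt0.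
by have [] := H Aw; move: WW; rewrite -subr_gt0 => /[swap] ->; rewrite ltxx.
Qed.

Lemma is_condexp_unique Y W W' : is_condexp P G Y W -> is_condexp P G Y W' ->
  {ae P, forall w, W w = W' w}.
Proof.
move=> c c'; have h := is_condexp_ltW_null c c'; have h' := is_condexp_ltW_null c' c.
apply: filterS2 h h' => w /negP + /negP; rewrite -!leNgt => h h'.
by apply/eqP; rewrite eq_le h h'.
Qed.

Lemma ae_is_condexp Y Y' W : measurable_fun setT Y' -> {ae P, forall w, Y w = Y' w} ->
  is_condexp P G Y W -> is_condexp P G Y' W.
Proof.
move=> mY' YY' [iY iW mW EW]; have iY' := ae_L1 mY' YY' iY.
split => // A GA; rewrite EW//; have mA := g_sigma_algebra_measurable GA.
apply: ae_eq_integral => //.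
- by apply: measurable_funTS; exact: measurable_int iY.
- by apply: measurable_funTS; exact: measurable_int iY'.
- by apply: filterS YY' => w -> _.
Qed.

Lemma condexpP Y W : is_condexp P G Y W -> is_condexp P G Y (condexp P G Y).
Proof. by move=> YW; apply: (@xgetPex _ (cst 0) [set W | is_condexp P G Y W]); exists W. Qed.

Lemma measurable_condexp Y : measurable_fun setT (condexp P G Y).
Proof.
have [[W /condexpP[_ iW _ _]]|NW] := pselect (exists W, is_condexp P G Y W).
  exact: L1_measurable iW.
(* Without any version, [condexp] takes its default value, the constant 0. *)
by rewrite /condexp xgetPN// => W YW; apply: NW; exists W.
Qed.

End condexp_unique.

(** * Conditional expectations on the probability space as resampling on tuples *)

Section condexp_resampling.
Context {R : realType} d (T : measurableType d) (P : probability T R)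
  d' (S : measurableType d') (n : nat) (X : 'I_n -> {RV P >-> S}).
Hypothesis indX : mutually_independent X.
Local Notation mu := (law X).
Let mixP := mix_law indX.
Implicit Types (y z : n.-tuple S -> R) (Y Z : T -> R) (K : set 'I_n).

Let gen K := \bigcup_(k in K) g_sigma_algebra_preimage (X k).

Let mgen K : gen K `<=` measurable.
Proof. by move=> A [k _ [B mB <-]]; exact: measurable_funP. Qed.

Let measurable_mix_joint K (t0 : n.-tuple S) : measurable_fun
  (setT : set (g_sigma_algebraType (gen K))) (fun w => mix K (joint X w) t0).
Proof.
apply/measurable_fun_tnthP => i.
rewrite (_ : _ \o _ = fun w => if i \in K then X i w else tnth t0 i); last first.
  by apply/funext => w /=; rewrite tnth_mix tnth_mktuple.
case: (boolP (i \in K)) => [iK _ B mB|//].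
apply: sub_sigma_algebra; exists i; first by rewrite inE in iK.
by exists B.
Qed.

(** Sets of this form make up a sigma-algebra that contains the generators. *)
Let sigma_of_joint K A : sigma_of X K A -> exists B : set (n.-tuple S),
  [/\ measurable B, forall s t, B (mix K s t) = B s & A = joint X @^-1` B].
Proof.
pose C := [set A | exists B : set (n.-tuple S),
  [/\ measurable B, forall s t, B (mix K s t) = B s & A = joint X @^-1` B]].
apply: (@smallest_sub _ (sigma_algebra setT) (gen K) C).
  split.
  - by exists set0; split.
  - move=> _ [B [mB BK ->]]; exists (~` B); split; first exact: measurableC.
      by move=> s t; rewrite /setC/= BK.
    by rewrite setTD.
  - move=> F FC; pose B i := sval (cid (FC i)).
    have BP i : [/\ measurable (B i), forall s t, B i (mix K s t) = B i s & F i = joint X @^-1` B i].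
      by rewrite /B; case: cid.
    exists (\bigcup_i B i); split.
    + by apply: bigcup_measurable => i _; case: (BP i).
    + move=> s t; apply/propext; split => -[i _ Bi]; exists i => //.
        by case: (BP i) => _ /(_ s t) <-.
      by case: (BP i) => _ /(_ s t) ->.
    + rewrite preimage_bigcup; apply: eq_bigcupr => i _.
      by case: (BP i).
move=> _ [k Kk [B mB <-]]; exists (@tnth _ S ^~ k @^-1` B); split.
- by rewrite -[X in measurable X]setTI; exact: measurable_tnth.
- by move=> s t /=; rewrite tnth_mix mem_set.
- by rewrite setTI; apply/seteqP; split => w /=; rewrite tnth_mktuple.
Qed.

Let integral_joint y A B : L1 mu y -> measurable B -> A = joint X @^-1` B ->
  (\int[P]_(w in A) (y (joint X w))%:E)%E = (\int[mu]_s (\1_B s * y s))%:E.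
Proof.
move=> iy mB ->.
have i1 : L1 mu (fun s => \1_B s * y s).
  under eq_fun do rewrite mulrC.
  apply: (L1M_bounded (M := 1) iy) => [|s]; first exact: measurable_indic.
  by rewrite indicE; case: (_ \in _); rewrite ?normr1 ?normr0.
rewrite EFin_Rintegral// -(preserves_integral (joint_preserves X) i1).
rewrite [LHS]integral_mkcond; apply: eq_integral => w _ /=.
rewrite patchE indicE (_ : (w \in joint X @^-1` B) = (joint X w \in B)).
  by case: (_ \in B); rewrite ?mul1r ?mul0r.
by apply/idP/idP; rewrite !inE.
Qed.

Lemma is_condexp_cexp K y : L1 mu y ->
  is_condexp P (sigma_of X K) (y \o joint X) (cexp mu K y \o joint X).
Proof.
move=> iy; have ic := L1_cexp mixP K iy; split.
- exact: ((preserves_integrable (joint_preserves X) (measurable_int _ iy)).2 iy).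
- exact: ((preserves_integrable (joint_preserves X) (measurable_int _ ic)).2 ic).
(* Since [cexp mu K y] ignores the coordinates outside [K], these can be frozen at an arbitrary
   [t0]; the composite is then measurable for the variables indexed by [K]. *)
- move=> B mB; pose t0 := joint X point.
  have mc := measurableT_comp (measurable_cexp mixP K iy) (@measurable_mix_joint K t0).
  rewrite (_ : _ \o _ = cexp mu K y \o (fun w => mix K (joint X w) t0)).
    by have := mc measurableT _ mB; rewrite setTI.
  by apply/funext => w /=; rewrite cexp_invariant.
- move=> A /sigma_of_joint[B [mB BK AB]].
  rewrite (integral_joint ic mB AB) (integral_joint iy mB AB); congr EFin.
  have yB : L1 mu (fun s => y s * \1_B s).
    apply: (L1M_bounded (M := 1) iy) => [|s]; first exact: measurable_indic.
    by rewrite indicE; case: (_ \in _); rewrite ?normr1 ?normr0.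
  have cB : L1 mu (fun s => \1_B s * cexp mu K y s).
    under eq_fun do rewrite mulrC.
    apply: (L1M_bounded (M := 1) ic) => [|s]; first exact: measurable_indic.
    by rewrite indicE; case: (_ \in _); rewrite ?normr1 ?normr0.
  rewrite -[RHS]/(\int[mu]_x (fun s => \1_B s * y s) x).
  rewrite (_ : (fun s => \1_B s * y s) = fun s => y s * \1_B s); last first.
    by apply/funext => s; rewrite mulrC.
  (* The set [B] does not see the coordinates outside [K], so its indicator can be pulled out of the
     conditional expectation. *)
  rewrite -(Rintegral_cexp mixP K yB); apply: ae_Rintegral.
  + exact: L1_measurable cB.
  + exact: measurable_cexp mixP _ _ yB.
  + have BK' : mix_invariant K (\1_B : _ -> R) by move=> s t; rewrite !indicE /in_mem /= /in_set /= BK.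
    by apply: filterS (cexpM mixP iy BK') => s ->; rewrite mulrC.
Qed.

(** Equality is almost sure because [condexp] is a version chosen arbitrarily; measurability of [Y]
    is kept since almost sure equality does not give it. *)
Definition represents Y y :=
  [/\ measurable_fun setT Y, L1 mu y & {ae P, forall w, Y w = y (joint X w)}].

(** The chosen version and the resampled one are both conditional expectations of [Y], hence agree
    almost surely. *)
Lemma represents_condexp K Y y : represents Y y ->
  represents (condexp P (sigma_of X K) Y) (cexp mu K y).
Proof.
move=> [mY iy Yy]; split; [exact: measurable_condexp|exact: L1_cexp|].
have Yy' : {ae P, forall w, (y \o joint X) w = Y w} by apply: filterS Yy => w ->.
have H := ae_is_condexp (mgen (K := K)) mY Yy' (is_condexp_cexp K iy).
exact: (is_condexp_unique (mgen (K := K)) (condexpP H) H).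
Qed.

Lemma representsM Y y Z z : represents Y y -> represents Z z ->
  L1 mu (fun s => y s * z s) -> represents (fun w => Y w * Z w) (fun s => y s * z s).
Proof.
move=> [mY _ Yy] [mZ _ Zz] iyz; split => //; first exact: measurable_funM.
by apply: filterS2 Yy Zz => w -> ->.
Qed.

Lemma representsD Y y Z z : represents Y y -> represents Z z ->
  represents (fun w => Y w + Z w) (fun s => y s + z s).
Proof.
move=> [mY iy Yy] [mZ iz Zz]; split; [exact: measurable_funD|exact: L1D|].
by apply: filterS2 Yy Zz => w -> ->.
Qed.

Lemma represents_norm Y y : represents Y y ->
  represents (fun w => `|Y w|) (fun s => `|y s|).
Proof.
move=> [mY iy Yy]; split; [exact: measurableT_comp|exact: L1_norm|].
by apply: filterS Yy => w ->.
Qed.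

Lemma represents_sum (Y : 'I_n -> T -> R) (y : 'I_n -> n.-tuple S -> R) :
  (forall i, represents (Y i) (y i)) ->
  represents (fun w => \sum_(i < n) Y i w) (fun s => \sum_(i < n) y i s).
Proof.
move=> r; split.
- by apply: measurable_sum => i; case: (r i).
- by apply: L1_sum => i; case: (r i).
- have : {ae P, forall w i, Y i w = y i (joint X w)}.
    by apply: filter_forall => i; case: (r i).
  by apply: filterS => w H; apply: eq_bigr.
Qed.

Lemma represents_Dop i Y y : represents Y y -> represents (Dop X i Y) (diff_op mu i y).
Proof.
move=> r; have [mY iy Yy] := r.
have [mE iE YE] := @represents_condexp [set k | k != i] _ _ r.
split; [exact: measurable_funB|exact: L1B|].
by apply: filterS2 Yy YE => w; rewrite /Dop /Ei => -> ->.
Qed.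

Lemma represents_Ei i Y y : represents Y y -> represents (Ei X i Y) (cexp_except mu i y).
Proof. exact: represents_condexp. Qed.

Lemma represents_Efilt i Y y : represents Y y ->
  represents (Efilt X i (Dop X i Y)) (mart_diff mu i y).
Proof. by move=> /represents_Dop r; exact: represents_condexp. Qed.

End condexp_resampling.

(** * Moment and Efron-Stein inequalities with possibly infinite values *)

Section extended_moments.
Context {R : realType} d (T : measurableType d) (P : probability T R).
Implicit Type y : T -> R.
Local Notation E y := (\int[P]_x y x).

Lemma L2_or_integral_sqr_pinfty y : measurable_fun setT y ->
  L2 P y \/ (\int[P]_x (y x ^+ 2)%:E = +oo)%E.
Proof.
move=> my; have [H|H] := pselect (L1 P (fun x => y x ^+ 2)); [by left|right].
apply/eqP; rewrite -leye_eq leNgt; apply/negP => lty; apply: H.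
apply/integrableP; split; first by apply/measurable_EFinP; exact: measurable_funX.
by under eq_integral do rewrite /= ger0_norm ?sqr_ge0//.
Qed.

Lemma Rintegral_norm_le_sqrte y : measurable_fun setT y ->
  ((E (fun x => `|y x|))%:E <= sqrte (\int[P]_x (y x ^+ 2)%:E))%E.
Proof.
move=> my; have [y2|->] := L2_or_integral_sqr_pinfty my; last by rewrite leey.
rewrite -EFin_Rintegral; last exact: (proj2 y2).
rewrite /= lee_fin -[leLHS]ger0_norm ?Rintegral_ge0// -sqrtr_sqr ler_wsqrtr//.
apply: (le_trans (sqr_Rintegral_le (L2_norm y2))).
by rewrite le_eqVlt; apply/orP; left; apply/eqP/eq_Rintegral => x _; rewrite real_normK// num_real.
Qed.

End extended_moments.

Section extended_efron_stein.
Context {R : realType} d (S : measurableType d) (n : nat).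
Variable mu : probability (n.-tuple S) R.
Hypothesis mixP : forall K, preserves (mu \x mu)%E mu
  (fun z : n.-tuple S * n.-tuple S => mix K z.1 z.2).

(** If some difference is not square-integrable, the right-hand side is infinite. *)
Lemma efron_stein_ereal y : L1 mu y ->
  (\int[mu]_s ((y s - \int[mu]_x y x) ^+ 2)%:E <=
   \sum_(i < n) \int[mu]_s (diff_op mu i y s ^+ 2)%:E)%E.
Proof.
move=> iy; have mD i : measurable_fun setT (diff_op mu i y).
  exact: L1_measurable (L1_diff_op mixP i iy).
have [D2|/existsNP[i Di]] := pselect (forall i, L2 mu (diff_op mu i y)).
  have [y2 le] := efron_stein mixP iy D2.
  rewrite (eq_bigr (fun i => (\int[mu]_s (diff_op mu i y s ^+ 2))%:E)); last first.
    by move=> i _; rewrite EFin_Rintegral//; exact: (proj2 (D2 i)).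
  rewrite sumEFin -EFin_Rintegral ?lee_fin//.
  by apply: (proj2 (L2B y2 (L2_cst mu _))).
have [//|Dioo] := L2_or_integral_sqr_pinfty mu (mD i).
rewrite (bigD1 i)//= Dioo addye ?leey// gt_eqF// (lt_le_trans ltNy0)//.
by apply: sume_ge0 => j _; apply: integral_ge0 => s _; rewrite lee_fin sqr_ge0.
Qed.

End extended_efron_stein.

(** * Transfer of moments, Lyapunov ratios and kernels to tuples *)

Section moments_of_representatives.
Context {R : realType} d (T : measurableType d) (P : probability T R)
  d' (S : measurableType d') (n : nat) (X : 'I_n -> {RV P >-> S}).
Hypothesis indX : mutually_independent X.
Local Notation mu := (law X).
Let mixP := mix_law indX.
Implicit Types (y : n.-tuple S -> R) (Y : T -> R).

Lemma expectation_represents Y y : represents X Y y ->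
  ('E_P[Y] = (\int[mu]_s y s)%R%:E)%E.
Proof.
move=> [mY iy Yy]; rewrite unlock EFin_Rintegral//.
rewrite -(preserves_integral (joint_preserves X) iy).
apply: ae_eq_integral => //; first exact/measurable_EFinP.
- by apply/measurable_EFinP/(measurableT_comp (L1_measurable iy)); exact: measurable_joint.
- by apply: filterS Yy => w /= ->.
Qed.

Lemma expectation_comp_represents (g : R -> R) Y y : measurable_fun setT g ->
  (forall r, 0 <= g r) -> represents X Y y ->
  ('E_P[fun w => g (Y w)] = \int[mu]_s (g (y s))%:E)%E.
Proof.
move=> mg g0 [mY iy Yy]; rewrite unlock.
have mgy : measurable_fun setT (fun s => (g (y s))%:E).
  by apply/measurable_EFinP/(measurableT_comp mg); exact: L1_measurable iy.
rewrite -(preserves_ge0_integral (joint_preserves X) mgy); last first.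
  by move=> s; rewrite lee_fin.
apply: ae_eq_integral => //.
- exact/measurable_EFinP/(measurableT_comp mg).
- by apply: (measurableT_comp mgy); exact: measurable_joint.
- by apply: filterS Yy => w /= ->.
Qed.

Lemma variance_represents Y y : represents X Y y ->
  ('V_P[Y] = \int[mu]_s ((y s - (\int[mu]_x y x)%R) ^+ 2)%:E)%E.
Proof.
move=> r; rewrite /variance unlock (expectation_represents r)/=.
set m := \int[mu]_s y s.
rewrite -(@expectation_comp_represents (fun u => (u - m) ^+ 2) Y)//.
- by apply: measurable_funX; exact: measurable_funB.
- by move=> u; exact: sqr_ge0.
Qed.

Lemma Lyapunov2_represents Y y : represents X Y y ->
  Lyapunov X 2 Y = (\sum_(i < n) \int[mu]_s (diff_op mu i y s ^+ 2)%:E)%E.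
Proof.
move=> r; apply: eq_bigr => i _.
rewrite -(@expectation_comp_represents (fun u => u ^+ 2) (Dop X i Y))//.
- congr expectation; apply/funext => w.
  by rewrite -[2]/(2%:R) powR_mulrn// real_normK// num_real.
- by move=> u; exact: sqr_ge0.
- exact: represents_Dop.
Qed.

Lemma variance_le_Lyapunov2 Y y : represents X Y y -> ('V_P[Y] <= Lyapunov X 2 Y)%E.
Proof.
move=> r; rewrite (variance_represents r) (Lyapunov2_represents r).
by apply: efron_stein_ereal => //; case: r.
Qed.

Lemma Lyapunov_ge0 (p : R) Y : (0 <= Lyapunov X p Y)%E.
Proof.
apply: sume_ge0 => i _; rewrite unlock; apply: integral_ge0 => w _.
by rewrite lee_fin powR_ge0.
Qed.

Lemma represents_Zvar F f : represents X F f -> L2 mu f ->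
  represents X (Zvar X F) (stein_kernel mu f).
Proof.
move=> r f2; apply: represents_sum => i; apply: representsM.
- exact: represents_Dop.
- exact: represents_Efilt.
- by apply: L2M; [|apply: L2_mart_diff => //]; exact: L2_diff_op.
Qed.

Lemma represents_Zbarvar F f : represents X F f -> L2 mu f ->
  represents X (Zbarvar X F) (stein_kernel_abs mu f).
Proof.
move=> r f2; have rA i := represents_norm (represents_Efilt indX i r).
apply: represents_sum => i; apply: represents_Dop => //; apply: representsM.
- exact: represents_Dop.
- by apply: representsD => //; exact: represents_Ei.
- have A2 := L2_norm (L2_mart_diff mixP (L2_diff_op mixP i f2)).
  by apply: L2M; [exact: L2_diff_op|apply: L2D => //; exact: L2_cexp].
Qed.

End moments_of_representatives.

(** * Means of the two kernels *)

Section kernel_means.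
Context {R : realType} d (S : measurableType d) (n : nat).
Variable mu : probability (n.-tuple S) R.
Hypothesis mixP : forall K, preserves (mu \x mu)%E mu
  (fun z : n.-tuple S * n.-tuple S => mix K z.1 z.2).
Variable f : n.-tuple S -> R.
Hypothesis f2 : L2 mu f.

(** The covariance identity of [f] with itself. *)
Lemma Rintegral_stein_kernel : \int[mu]_s f s = 0 ->
  \int[mu]_s stein_kernel mu f s = \int[mu]_s (f s ^+ 2).
Proof.
move=> f0; have D2 i := L2_diff_op mixP i f2.
have A2 i := L2_mart_diff mixP (D2 i).
rewrite Rintegral_sum; last by move=> i; exact: L2M.
transitivity (\int[mu]_s ((f s - \int[mu]_x f x) * f s)).
  rewrite (Rintegral_center_mul mixP (L2_L1 f2))//; apply: eq_bigr => i _.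
  by apply: eq_Rintegral => s _; rewrite mulrC.
by apply: eq_Rintegral => s _; rewrite f0 subr0 expr2.
Qed.

Lemma Rintegral_stein_kernel_abs : \int[mu]_s stein_kernel_abs mu f s = 0.
Proof.
rewrite Rintegral_sum; last by move=> i; exact: L1_stein_kernel_abs_summand.
apply: big1 => i _; rewrite /stein_kernel_abs_summand; set W := (X in diff_op mu i X).
have iW : L1 mu W.
  have D2 := L2_diff_op mixP i f2; have A2 := L2_norm (L2_mart_diff mixP D2).
  by apply: L2M => //; apply: L2D => //; exact: L2_cexp.
rewrite /diff_op RintegralB//; last exact: L1_cexp.
by rewrite Rintegral_cexp// subrr.
Qed.

End kernel_means.

Theorem corollary3p2 (R : realType)
  (d : measure_display) (T : measurableType d) (P : probability T R)
  (d' : measure_display) (S : measurableType d')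
  (n : nat) (X : 'I_n -> {RV P >-> S})
  (f : n.-tuple S -> R)
  (d'' : measure_display) (T' : measurableType d'') (Q : probability T' R)
  (N : {RV Q >-> R})
  (sigma : R) :
  mutually_independent X ->
  measurable_fun [set: n.-tuple S] f ->
  standard_normal N ->
  let F : T -> R := fun w => f [tuple X i w | i < n] in
  ('E_P[F] = 0)%E ->
  0 < sigma ->
  ('E_P[fun w => (F w ^+ 2)%R] = (sigma ^+ 2)%:E)%E ->
  let Z := Zvar X F in
  let Zbar := Zbarvar X F in
  let rest : \bar R :=
    ((3 * Num.sqrt n%:R / sigma ^+ 4)%:E * Lyapunov X 4 F
     + (Num.sqrt (2 * pi) / (4 * sigma ^+ 3))%:E * Lyapunov X 3 F)%E in
  let bound : \bar R :=
    (sqrte 'V_P[Z] / (sigma ^+ 2)%:E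
     + sqrte 'V_P[Zbar] / (sigma ^+ 2)%:E + rest)%E in
  (d_K P Q (fun w => (sigma^-1 * F w)%R) N <= bound)%E /\
  (bound <= sqrte (Lyapunov X 2 Z) / (sigma ^+ 2)%:E
            + sqrte (Lyapunov X 2 Zbar) / (sigma ^+ 2)%:E + rest)%E.
Proof.
move=> indX mf stdN F EF0 sigma0 EF2 Z Zbar rest bound.
have mixP := mix_law indX; set mu := law X in mixP.
have mF : measurable_fun setT F by exact: measurableT_comp mf (measurable_joint X).
have mf2 : measurable_fun setT (fun s => (f s ^+ 2)%:E).
  by apply/measurable_EFinP; exact: measurable_funX.
have If2 : (\int[mu]_s (f s ^+ 2)%:E)%E = (sigma ^+ 2)%:E.
  rewrite -EF2 unlock -(preserves_ge0_integral (joint_preserves X) mf2)//.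
  by move=> s; rewrite lee_fin sqr_ge0.
have f2 : L2 mu f.
  by have [//|] := L2_or_integral_sqr_pinfty mu mf; rewrite If2.
have rF : represents X F f.
  by split => //; [exact: L2_L1|apply: aeW => w].
have f0 : \int[mu]_s f s = 0.
  by apply/EFin_inj; rewrite -(expectation_represents rF).
have Ef2 : \int[mu]_s (f s ^+ 2) = sigma ^+ 2 by rewrite /Rintegral If2.
have rZ := represents_Zvar indX rF f2; have rZbar := represents_Zbarvar indX rF f2.
have s2 : 0 < sigma ^+ 2 by rewrite exprn_gt0.
have rest0 : (0 <= rest)%E.
  by apply: adde_ge0; apply: mule_ge0; rewrite ?Lyapunov_ge0// lee_fin divr_ge0//
    ?mulr_ge0// ?exprn_ge0// ltW.
have divE (a : \bar R) : (a / (sigma ^+ 2)%:E = a * ((sigma ^+ 2)^-1)%:E)%E.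
  by rewrite inver gt_eqF.
have sV0 : 0 <= (sigma ^+ 2)^-1 by rewrite invr_ge0 ltW.
split; last first.
  apply: leeD => //; apply: leeD; rewrite !divE lee_wpmul2r ?lee_fin//.
    by rewrite lee_sqrt ?Lyapunov_ge0//; exact: (variance_le_Lyapunov2 indX rZ).
  by rewrite lee_sqrt ?Lyapunov_ge0//; exact: (variance_le_Lyapunov2 indX rZbar).
(* [Z] has mean [sigma ^+ 2], so its mean absolute deviation is at most its standard deviation;
   [Zbar] below has mean 0. *)
have bndZ : ((sigma ^- 2 * \int[mu]_s `|stein_kernel mu f s - sigma ^+ 2|)%:E
    <= sqrte 'V_P[Z] / (sigma ^+ 2)%:E)%E.
  rewrite divE mulrC EFinM lee_wpmul2r ?lee_fin// (variance_represents rZ).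
  rewrite (Rintegral_stein_kernel mixP f2 f0) Ef2.
  apply: (Rintegral_norm_le_sqrte mu).
  by apply: measurable_funB => //; exact: L1_measurable (L1_stein_kernel mixP f2).
have bndZbar : ((sigma ^- 2 * \int[mu]_s `|stein_kernel_abs mu f s|)%:E
    <= sqrte 'V_P[Zbar] / (sigma ^+ 2)%:E)%E.
  rewrite divE mulrC EFinM lee_wpmul2r ?lee_fin// (variance_represents rZbar).
  rewrite (Rintegral_stein_kernel_abs mixP f2).
  under eq_integral do rewrite subr0.
  exact: (Rintegral_norm_le_sqrte mu (L1_measurable (L1_stein_kernel_abs mixP f2))).
apply: ge_ereal_sup => _ [x _ <-].
(* The two variance terms bound the distance, and [rest], being nonnegative, can be added. *)
apply: (@le_trans _ _ (sqrte 'V_P[Z] / (sigma ^+ 2)%:E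
  + sqrte 'V_P[Zbar] / (sigma ^+ 2)%:E))%E; last first.
  by rewrite -[leLHS]adde0; exact: leeD.
apply: le_trans (leeD bndZ bndZbar).
have -> : P [set w | sigma^-1 * F w <= x] =
    (\int[mu]_s ((sigma^-1 * f s <= x)%R%:R : R))%:E.
  pose A := [set s | sigma^-1 * f s <= x].
  have mA : measurable A.
    have h : measurable_fun setT (fun s => sigma^-1 * f s) by exact: measurable_funM.
    have := h measurableT `]-oo, x]%classic (measurable_itv _).
    by rewrite setTI (_ : _ @^-1` _ = A)//; apply/seteqP; split => s /=; rewrite in_itv.
  rewrite (_ : [set w | _] = joint X @^-1` A)// (joint_preserves X).2//.
  rewrite /Rintegral (_ : (fun s => _) = fun s => (\1_A s)%:E).
    by rewrite integral_indic// setIT fineK// fin_num_measure.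
  by apply/funext => s; rewrite indicE /in_mem /= /in_set /= asboolb.
have -> : Q [set w | N w <= x] = (normal_cdf x)%:E.
  rewrite (_ : [set w | N w <= x] = N @^-1` `]-oo, x]%classic); last first.
    by apply/seteqP; split => w /=; rewrite in_itv.
  by rewrite /normal_cdf fineK ?fin_num_measure//; exact: stdN (measurable_itv _).
rewrite -EFinB /= lee_fin.
have tau0 : 0 <= sigma^-1 by rewrite invr_ge0 ltW.
(* The scaling is [tau = sigma^-1]; what remains is to take [sigma ^- 2] out of the first absolute
   value. *)
apply: (le_trans (normal_cdf_sub_le mixP f2 stdN x tau0 f0)).
rewrite exprVn lerD2r.
have iZ := L1_norm (L1B (L1_stein_kernel mixP f2) (L1_cst mu (sigma ^+ 2))).
rewrite -RintegralZl// le_eqVlt; apply/orP; left; apply/eqP.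
apply: eq_Rintegral => s _.
by rewrite -{2}(ger0_norm sV0) -normrM distrC mulrBr mulVf// gt_eqF.
Qed.
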